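(* For $c\ge2$ assume the conjecture stated in the context. Let $\lambda=L_{s+1}/L_s$ be the stretching factor of two consecutive subintervals $s$, $s+1$ of lengths $L_s$, $L_{s+1}$. 1. For 2 consecutive non-uniform subintervals of type $Q,Q$ let the nodes and weights be defined by the polynomials $Q_n(\mathbf l,x)$ and $Q_m(RecS_{n,\lambda}(\mathbf l),x)$. The quadrature rule so given is exact for splines with a support of 1 or 2 intervals, when the spline degree $d$ is $\le\min(2n+c,\,2m+c)$. 2. For 2 consecutive non-uniform subintervals of type $Q,M$ let the nodes and weights be defined by the polynomials $Q_n(\mathbf l,x)$ and $M_m(RecS_{n,\lambda}(\mathbf l),\mathbf r,x)$. The quadrature rule so given is exact for splines with a support of 1 or 2 intervals, when the spline degree $d$ is $\le\min(2n+c,\,2m-1)$.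
   Context: Weights and orthogonal polynomials. Let $c\ge0$ be the continuity class and $\mathbb D=\mathbb R^{c+1}$. For $\mathbf l=(l_0,\dots,l_c)$, $\mathbf r=(r_0,\dots,r_c)\in\mathbb D$ let, on $[-1,+1]$, $$W_Q(\mathbf l,x)=(1-x)^{c+1}\Bigl(1+\sum_{i=0}^{c}l_i\delta^{(i)}(x+1)\Bigr),\qquad W_M(\mathbf l,\mathbf r,x)=1+\sum_{i=0}^{c}l_i\delta^{(i)}(x+1)+\sum_{i=0}^{c}(-1)^ir_i\delta^{(i)}(x-1),$$ where $\int\delta^{(k)}(x+a)f(x)\,dx=(-1)^kf^{(k)}(-a)$. $Q_m(\mathbf l,x)$ and $M_m(\mathbf l,\mathbf r,x)$ (of degree $m$) are the polynomials orthogonal with respect to $W_Q$ and $W_M$ respectively: $\int_{-1}^{+1}W_QQ_mQ_k\,dx=0$ and $\int_{-1}^{+1}W_MM_mM_k\,dx=0$ for $m\ne k$. They are normalized by $Q_m(\mathbf 0,x)=P_m^{(c+1,0)}(x)$ (Jacobi) and $M_m(\mathbf 0,\mathbf 0,x)=P_m(x)$ (Legendre), and have no factors depending only on the parameters and not on $x$. Their non-zero scalar products are $S_Q(m,\mathbf l)=\int_{-1}^{+1}W_QQ_m^2\,dx$ and $S_M(m,\mathbf l,\mathbf r)=\int_{-1}^{+1}W_MM_m^2\,dx$. Nodes and weights. In the following, $a_m$ is the coefficient of $x^m$ in the respective polynomial of index $m$. The rule on $[-1,+1]$ defined by $Q_n(\mathbf l,x)$ has the roots $x_i$ of $Q_n(\mathbf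 l,x)$ as nodes and the weights $w_i=\frac{a_n}{a_{n-1}}\frac{S_Q(n-1,\mathbf l)}{Q_n'(\mathbf l,x_i)Q_{n-1}(\mathbf l,x_i)(1-x_i)^{c+1}}$. The rule defined by $M_n(\mathbf l,\mathbf r,x)$ has the roots $x_i$ of $M_n(\mathbf l,\mathbf r,x)$ as nodes and the weights $w_i=\frac{a_n}{a_{n-1}}\frac{S_M(n-1,\mathbf l,\mathbf r)}{M_n'(\mathbf l,\mathbf r,x_i)M_{n-1}(\mathbf l,\mathbf r,x_i)}$. The rule is transported to a subinterval $[t,t+L]$ by $x_i\mapsto t+L(x_i+1)/2$, $w_i\mapsto Lw_i/2$. A subinterval is of type $Q$ (resp. $M$) if its nodes and weights are given by such a polynomial $Q_n$ (resp. $M_n$). Quadrature rules are understood without positivity of the weights or other conditions on the roots. Splines. Splines are piecewise polynomial of degree $d$ and of class $C^c$. For a spline with a support of 1 or 2 intervals, the derivatives of orders $0,\dots,c$ vanish at the ends of the support. The rule is exact for a spline if the weighted sum of its values, each subinterval's polynomial piece being evaluated at that subinterval's nodes, equals its integral. Conjecture and maps. Let $\mathbb J=\mathbb{RP}^{c+1}$ with homogeneous coordinates $(j_0:\dots:j_{c+1})$, and let $J_m(x)=P_m^{(c+1,c+1)}(x)$, polynomials of negative index being $0$. Let $r:\mathbb J\to\mathbb J$ be $j_i\mapsto(-1)^ij_i$. The conjecture states: $Q_n(\mathbf l,x)=\sum_{i=0}^{c+1}j_{n,i}(\mathbf l)J_{n-i}(x)$ with coefficients $j_{n,i}(\mathbf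 l)$ polynomial in the components of $\mathbf l$ and $n$; likewise $M_n(\mathbf l,\mathbf r,x)=\sum_{i=0}^{2c+3}j_{n,i}(\mathbf l,\mathbf r)J_{n-i}(x)$ with other coefficients; and the polynomial map $f_n:\mathbb D\to\mathbb J$, $\mathbf l\mapsto(j_{n,0}(\mathbf l):\dots:j_{n,c+1}(\mathbf l))$, formed from the coefficients of $Q_n$, has an inverse $f_n^{-1}:\mathbb J\to\mathbb D$ with components rational in $\mathbf j$. Connection map: $C:\mathbb D\to\mathbb D$, $l_i\mapsto(-1)^{i+1}l_i$. Recursion map: $Rec_n=C\circ(f_n^{-1}\circ r\circ f_n)$. Stretching map: $S_\lambda:\mathbb D\to\mathbb D$, $l_i\mapsto l_i/\lambda^{i+1}$. Recursion map with stretching: $RecS_{n,\lambda}=S_\lambda\circ Rec_n=S_\lambda\circ C\circ(f_n^{-1}\circ r\circ f_n)$. *)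

(* Defs.v *)
From HB Require Import structures.
From mathcomp Require Import all_boot all_order all_algebra.
From mathcomp Require Import all_classical all_reals all_analysis.
From mathcomp Require Import complex.
(* The notations of mpoly clash with those of all_analysis. *)
From mathcomp Require Import -(notations) mpoly.

Set Implicit Arguments.
Unset Strict Implicit.
Unset Printing Implicit Defensive.

Import Order.TTheory GRing.Theory Num.Theory.

Local Open Scope classical_set_scope.
Local Open Scope ring_scope.

(* P_n^{(a,b)}(x)
     = sum_s C(n+a, n-s) C(n+b, s) ((x-1)/2)^s ((x+1)/2)^(n-s). *)
Definition jacobi (R : fieldType) (a b n : nat) : {poly R} :=
  \sum_(s < n.+1) ('C(n + a, n - s) * 'C(n + b, s))%:R / 2 ^+ n
      *: (('X - 1) ^+ s * ('X + 1) ^+ (n - s)).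

Definition legendre (R : fieldType) (n : nat) : {poly R} := jacobi R 0 0 n.

Definition Jpoly (R : fieldType) (c : nat) (m : int) : {poly R} :=
  match m with Posz k => jacobi R c.+1 c.+1 k | Negz _ => 0 end.

(* The space D = R^{c+1} of parameter vectors. *)
Notation params R c := ('I_c.+1 -> R).

(* \int delta^(k)(x + a) f(x) dx *)
Definition delta_int (R : realType) (k : nat) (a : R) (f : {poly R}) : R :=
  (-1) ^+ k * (f^`(k)).[- a].

(* \int_{-1}^{1} W_Q(l, x) f(x) dx *)
Definition WQ_int (R : realType) (c : nat) (l : params R c) (f : {poly R}) : R :=
  let g := (1 - 'X) ^+ c.+1 * f in
  (\int[lebesgue_measure]_(x in `[(-1 : R), 1]) g.[x])
  + \sum_(i < c.+1) l i * delta_int i 1 g.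

(* \int_{-1}^{1} W_M(l, r, x) f(x) dx *)
Definition WM_int (R : realType) (c : nat) (l r : params R c) (f : {poly R}) : R :=
  (\int[lebesgue_measure]_(x in `[(-1 : R), 1]) f.[x])
  + \sum_(i < c.+1) l i * delta_int i 1 f
  + \sum_(i < c.+1) (-1) ^+ i * r i * delta_int i (- 1) f.

(* Q_m(l, x) and M_m(l, r, x) are polynomials in x whose coefficients are
   polynomials in the parameters; spec v evaluates the parameters at v. *)
Definition spec (R : realType) (k : nat) (v : 'I_k -> R)
    (p : {poly mpoly k R}) : {poly R} :=
  map_poly (meval v) p.

Definition lr (R : realType) (c : nat) (l r : params R c) : 'I_(c.+1 + c.+1) -> R :=
  fun k => match fintype.split k with inl i => l i | inr i => r i end.

Definition no_parameter_factor (R : realType) (k : nat) (p : {poly mpoly k R}) : Prop :=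
  forall (g : mpoly k R) (p' : {poly mpoly k R}),
    p = g *: p' -> exists a : R, g = mpolyC k a.

Definition is_Q_family (R : realType) (c : nat)
    (Q : nat -> {poly mpoly c.+1 R}) : Prop :=
  [/\ forall m, size (Q m) = m.+1,
      forall m k, m <> k -> forall l : params R c,
        WQ_int l (spec l (Q m) * spec l (Q k)) = 0,
      forall m, spec (fun=> 0) (Q m) = jacobi R c.+1 0 m
    & forall m, no_parameter_factor (Q m)].

Definition is_M_family (R : realType) (c : nat)
    (M : nat -> {poly mpoly (c.+1 + c.+1) R}) : Prop :=
  [/\ forall m, size (M m) = m.+1,
      forall m k, m <> k -> forall l r : params R c,
        WM_int l r (spec (lr l r) (M m) * spec (lr l r) (M k)) = 0,
      forall m, spec (fun=> 0) (M m) = legendre R m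
    & forall m, no_parameter_factor (M m)].

Definition toC (R : realType) (p : {poly R}) : {poly R[i]} :=
  map_poly (real_complex R) p.

(* No condition is put on the location of the nodes: they are all the roots in
   the field R[i] of complex numbers. *)
Definition nodes (R : realType) (p : {poly R}) : seq R[i] :=
  sval (closed_field_poly_normal (toC p)).

Section Rules.
Local Open Scope complex_scope.

Definition Q_den (R : realType) (c : nat) (Q : nat -> {poly mpoly c.+1 R})
    (n : nat) (l : params R c) (x : R[i]) : R[i] :=
  (toC (spec l (Q n)))^`().[x] * (toC (spec l (Q n.-1))).[x] * (1 - x) ^+ c.+1.

Definition Q_weight (R : realType) (c : nat) (Q : nat -> {poly mpoly c.+1 R})
    (n : nat) (l : params R c) (x : R[i]) : R[i] :=
  ((spec l (Q n))`_n / (spec l (Q n.-1))`_n.-1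
    * WQ_int l (spec l (Q n.-1) ^+ 2))%:C / Q_den Q n l x.

(* At the given parameter values Q_n still has degree n and no weight has a
   vanishing denominator (so that in particular the nodes are distinct). *)
Definition Q_rule_defined (R : realType) (c : nat) (Q : nat -> {poly mpoly c.+1 R})
    (n : nat) (l : params R c) : Prop :=
  [/\ (0 < n)%N, (spec l (Q n))`_n != 0, (spec l (Q n.-1))`_n.-1 != 0
    & forall x, x \in nodes (spec l (Q n)) -> Q_den Q n l x != 0].

Definition M_den (R : realType) (c : nat) (M : nat -> {poly mpoly (c.+1 + c.+1) R})
    (n : nat) (l r : params R c) (x : R[i]) : R[i] :=
  (toC (spec (lr l r) (M n)))^`().[x] * (toC (spec (lr l r) (M n.-1))).[x].

Definition M_weight (R : realType) (c : nat) (M : nat -> {poly mpoly (c.+1 + c.+1) R})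
    (n : nat) (l r : params R c) (x : R[i]) : R[i] :=
  ((spec (lr l r) (M n))`_n / (spec (lr l r) (M n.-1))`_n.-1
    * WM_int l r (spec (lr l r) (M n.-1) ^+ 2))%:C / M_den M n l r x.

Definition M_rule_defined (R : realType) (c : nat)
    (M : nat -> {poly mpoly (c.+1 + c.+1) R}) (n : nat) (l r : params R c) : Prop :=
  [/\ (0 < n)%N, (spec (lr l r) (M n))`_n != 0,
      (spec (lr l r) (M n.-1))`_n.-1 != 0
    & forall x, x \in nodes (spec (lr l r) (M n)) -> M_den M n l r x != 0].

(* The rule with nodes xs and weights w on [-1, 1], transported to [t, t + L]
   and applied to the polynomial p. *)
Definition rule_on (R : realType) (xs : seq R[i]) (w : R[i] -> R[i])
    (t L : R) (p : {poly R}) : R[i] :=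
  \sum_(x <- xs) (L%:C * w x / 2) * (toC p).[t%:C + L%:C * (x + 1) / 2].

Definition Q_rule (R : realType) (c : nat) (Q : nat -> {poly mpoly c.+1 R})
    (n : nat) (l : params R c) : R -> R -> {poly R} -> R[i] :=
  rule_on (nodes (spec l (Q n))) (Q_weight Q n l).

Definition M_rule (R : realType) (c : nat) (M : nat -> {poly mpoly (c.+1 + c.+1) R})
    (n : nat) (l r : params R c) : R -> R -> {poly R} -> R[i] :=
  rule_on (nodes (spec (lr l r) (M n))) (M_weight M n l r).

(* A spline of degree d and class C^c supported in [t0, t1] `|` [t1, t2], with
   pieces p and q. A support reduced to one of the intervals is the case where
   the other piece is 0. *)
Definition is_spline (R : realType) (c d : nat) (t0 t1 t2 : R) (p q : {poly R}) : Prop :=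
  [/\ (size p <= d.+1)%N, (size q <= d.+1)%N,
      forall k, (k <= c)%N -> p^`(k).[t0] = 0,
      forall k, (k <= c)%N -> p^`(k).[t1] = q^`(k).[t1]
    & forall k, (k <= c)%N -> q^`(k).[t2] = 0].

Definition spline_fun (R : realType) (t1 : R) (p q : {poly R}) (x : R) : R :=
  if x < t1 then p.[x] else q.[x].

Definition exact_for_splines (R : realType) (c d : nat) (t L1 L2 : R)
    (rule1 rule2 : R -> R -> {poly R} -> R[i]) : Prop :=
  let t1 := t + L1 in
  let t2 := t1 + L2 in
  forall p q : {poly R}, is_spline c d t t1 t2 p q ->
    rule1 t L1 p + rule2 t1 L2 q
    = (\int[lebesgue_measure]_(x in `[t, t2]) spline_fun t1 p q x)%:C.

End Rules.

(* Homogeneous coordinates on J = RP^{c+1}. *)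
Notation hcoords R c := ('I_c.+2 -> R).

Definition is_point (R : realType) (c : nat) (u : hcoords R c) : Prop :=
  exists i, u i != 0.

Definition same_point (R : realType) (c : nat) (u v : hcoords R c) : Prop :=
  exists2 k : R, k != 0 & forall i, u i = k * v i.

(* A rational map J -> D with components rnum i / rden i. *)
Record ratmap (R : realType) (c : nat) := RatMap {
  rnum : 'I_c.+1 -> mpoly c.+2 R;
  rden : 'I_c.+1 -> mpoly c.+2 R
}.

Definition ratmap_homog (R : realType) (c : nat) (g : ratmap R c) : Prop :=
  forall i, exists e : nat,
    rnum g i \is ishomog1 e mdeg /\ rden g i \is ishomog1 e mdeg.

Definition rdom (R : realType) (c : nat) (g : ratmap R c) (u : hcoords R c) : Prop :=
  is_point u /\ forall i, meval u (rden g i) != 0.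

Definition reval (R : realType) (c : nat) (g : ratmap R c) (u : hcoords R c) : params R c :=
  fun i => meval u (rnum g i) / meval u (rden g i).

(* g is an inverse of f : D -> J as a rational map. *)
Definition is_inverse (R : realType) (c : nat) (f : params R c -> hcoords R c)
    (g : ratmap R c) : Prop :=
  [/\ ratmap_homog g,
      exists l, rdom g (f l),
      forall l, rdom g (f l) -> reval g (f l) =1 l
    & forall u, rdom g u -> is_point (f (reval g u)) -> same_point (f (reval g u)) u].

(* j_{n,i} is polynomial in the parameters and in n: it is represented by a
   polynomial in n with coefficients polynomial in the parameters. Polynomiality
   in n fixes j_{n,i} also for i > n, where J_{n-i} = 0. *)
Definition jcoef (R : realType) (k N : nat) (j : 'I_N -> {poly mpoly k R})
    (n : nat) (v : 'I_k -> R) : 'I_N -> R :=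
  fun i => meval v (j i).[n%:R].

(* The j_{n,i} are homogeneous coordinates, so the expansion is required up to a
   non-zero factor kappa n not depending on the parameters. Such a factor is
   needed: already at l = 0 the coefficients of the normalized polynomial
   P_n^{(c+1,0)} are not polynomial in n, as in
     2 (n+1) P_n^{(1,0)} = (n+2) J_n + (n+1) J_{n-1}   for c = 0. *)
Definition expansion (R : realType) (c k N : nat) (P : nat -> {poly mpoly k R})
    (j : 'I_N -> {poly mpoly k R}) : Prop :=
  exists2 kappa : nat -> R, forall n, kappa n != 0
    & forall (n : nat) (v : 'I_k -> R),
        kappa n *: spec v (P n) = \sum_(i < N) jcoef j n v i *: Jpoly R c (n%:Z - i%:Z).

Definition Q_expansion (R : realType) (c : nat) (Q : nat -> {poly mpoly c.+1 R})
    (j : 'I_c.+2 -> {poly mpoly c.+1 R}) : Prop :=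
  expansion c Q j.

Definition M_expansion (R : realType) (c : nat) (M : nat -> {poly mpoly (c.+1 + c.+1) R})
    (j : 'I_(2 * c + 4) -> {poly mpoly (c.+1 + c.+1) R}) : Prop :=
  expansion c M j.

Definition fmap_n (R : realType) (c : nat) (j : 'I_c.+2 -> {poly mpoly c.+1 R})
    (n : nat) (l : params R c) : hcoords R c :=
  jcoef j n l.

Definition conjecture (R : realType) (c : nat) (Q : nat -> {poly mpoly c.+1 R})
    (M : nat -> {poly mpoly (c.+1 + c.+1) R}) : Prop :=
  (exists2 j, Q_expansion Q j & forall n, exists g, is_inverse (fmap_n j n) g)
  /\ exists j, M_expansion M j.

Definition reflection (R : realType) (c : nat) (u : hcoords R c) : hcoords R c :=
  fun i => (-1) ^+ i * u i.

Definition connection (R : realType) (c : nat) (l : params R c) : params R c :=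
  fun i => (-1) ^+ i.+1 * l i.

Definition stretching (R : realType) (c : nat) (lambda : R) (l : params R c) : params R c :=
  fun i => l i / lambda ^+ i.+1.

(* finv stands for f_n^{-1}. *)
Definition Rec (R : realType) (c : nat) (j : 'I_c.+2 -> {poly mpoly c.+1 R})
    (n : nat) (finv : ratmap R c) (l : params R c) : params R c :=
  connection (reval finv (reflection (fmap_n j n l))).

Definition RecS (R : realType) (c : nat) (j : 'I_c.+2 -> {poly mpoly c.+1 R})
    (n : nat) (finv : ratmap R c) (lambda : R) (l : params R c) : params R c :=
  stretching lambda (Rec j n finv l).

Definition Rec_defined (R : realType) (c : nat) (j : 'I_c.+2 -> {poly mpoly c.+1 R})
    (n : nat) (finv : ratmap R c) (l : params R c) : Prop :=
  is_point (fmap_n j n l) /\ rdom finv (reflection (fmap_n j n l)).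

(* Main.v *)
Require Import Defs.
From HB Require Import structures.
From mathcomp Require Import all_boot all_order all_algebra.
From mathcomp Require Import all_classical all_reals all_analysis.
From mathcomp Require Import complex.
From mathcomp Require Import -(notations) mpoly.
From mathcomp Require Import ring zify.

Set Implicit Arguments.
Unset Strict Implicit.
Unset Printing Implicit Defensive.

Import Order.TTheory GRing.Theory Num.Theory.
Local Open Scope ring_scope.

(** A rule whose nodes are the roots of a polynomial orthogonal with respect to a
    functional, and whose weights have the Christoffel form, is exact for that
    functional ([interpolatory], [christoffel_weight]). So the question is which
    functionals a given [Q_n(l)] is orthogonal for. By definition it is
    orthogonal, for the measure with masses [l] at [-1], to the multiples of
    [(1 - x)^(c+1)] of degree less than [n+c+1]. The core of the proof,
    [Q_two_sided], is that it is orthogonal to all polynomials of degree less than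
    [n+c+1] once masses [l* = f_n^-1 (r (f_n l))] are added at [1].

    To see this, let [a = c+1] and write the combination of the [J_(n-i)] with
    coordinates [u] as the derivative of order [a] of [Phi n u], a combination of
    Legendre polynomials of degrees [n, ..., n+a]. Integrating by parts [a]
    times, the integral of [Phi^(a) f] against the two-sided measure becomes the
    sum of a form in the jet of [f] at [-1], which involves only the left masses
    ([Lform]), a form in the jet at [1], which involves only the right masses
    ([Rform]), and an integral that vanishes for [deg f < n + a] ([Wform_parts],
    [Phi_orth]). For [n > c] the orthogonality of [Q_n(l)] says exactly that the
    left form vanishes for [u = f_n l]. The substitution [x -> -x] exchanges the
    two forms and acts on the coordinates by [r] ([Lform_reflect],
    [Phi_reflect]). Hence the masses that belong at the right end point are those
    which the inverse of [f_n] attaches to [r (f_n l)].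

    Three identities known at generic places have to be extended to special
    ones: orthogonality to all polynomials of smaller degree at parameters where
    some polynomial of the family drops its degree ([Q_orth], [M_orth]); the
    vanishing of the left form for [n <= c], where some [J_(n-i)] are zero and the
    coordinates are no longer visible in [Q_n] ([Lform_fmap]); and the relation
    between a point [u] and [f_n^-1 u] where [f_n (f_n^-1 u)] may vanish
    ([Lform_inverse]). Each time the quantities depend rationally on an index, a
    point of a line or, up to the sign [(-1)^n], the number [n], and
    [ratfam_eq0] extends the identity.

    Finally, for a spline with pieces [p] and [q], the first rule returns the
    integral of [p] plus the masses [l*] applied to the jet of [p] at the common
    knot, and the second one the integral of [q] plus the masses of its left end
    point applied to the jet of [q]. The jets agree up to order [c], the
    connection map supplies the opposite sign and the stretching map the ratio of
    the lengths, so the masses cancel ([masses_cancel]). *)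

(** * Integration of polynomials *)

Section PolynomialIntegral.
Import numFieldNormedType.Exports.
Variable R : realType.
Implicit Types (p q : {poly R}) (a b x : R).

Definition antideriv p : {poly R} :=
  \poly_(i < (size p).+1) (p`_i.-1 / i%:R).

Lemma coef_antideriv p i : (antideriv p)`_i = p`_i.-1 / i%:R.
Proof.
rewrite coef_poly; case: ltnP => // lt_p_i; rewrite nth_default ?mul0r //.
by case: i lt_p_i.
Qed.

Lemma deriv_antideriv p : (antideriv p)^`() = p.
Proof.
apply/polyP => i; rewrite coef_deriv coef_antideriv /=.
by rewrite -[_ *+ i.+1]mulr_natr divfK.
Qed.

Lemma antideriv_is_linear : linear antideriv.
Proof.
move=> k p q; apply/polyP => i.
by rewrite coefD coefZ !coef_antideriv coefD coefZ mulrDl mulrA.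
Qed.

Definition pint a b p : R := (antideriv p).[b] - (antideriv p).[a].

Lemma pint_is_linear a b : linear (pint a b : {poly R} -> R^o).
Proof.
move=> k p q; rewrite /pint antideriv_is_linear !hornerD !hornerZ /GRing.scale /=.
by ring.
Qed.

HB.instance Definition _ a b :=
  GRing.isLinear.Build R {poly R} R^o _ (pint a b) (pint_is_linear a b).

(** Two polynomials with the same derivative differ by a constant, so the
    chosen antiderivative does not matter. *)
Lemma pint_deriv a b p : pint a b p^`() = p.[b] - p.[a].
Proof.
have [k ->] : exists k, p = antideriv p^`() + k%:P.
  exists p`_0; apply/polyP => -[|i]; rewrite coefD coef_antideriv coefC /=.
    by rewrite invr0 mulr0 add0r.
  by rewrite coef_deriv addr0 -[_ *+ i.+1]mulr_natr mulfK ?pnatr_eq0.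
rewrite derivD derivC addr0 deriv_antideriv !hornerE /pint; ring.
Qed.

Lemma Rintegral_poly a b p : a < b ->
  \int[lebesgue_measure]_(x in [set` `[a, b]%R]) p.[x] = pint a b p.
Proof.
move=> ab; rewrite /Rintegral (@continuous_FTC2 _ _ (horner (antideriv p))) //.
- apply: continuous_subspaceT => x; exact: continuous_horner.
- split.
  + by move=> x _; exact: derivable_horner.
  + by apply: cvg_at_right_filter; exact: continuous_horner.
  + by apply: cvg_at_left_filter; exact: continuous_horner.
- by move=> x _; rewrite -derivE deriv_antideriv.
Qed.

Lemma integrable_poly a b p :
  lebesgue_measure.-integrable [set` `[a, b]%R] (EFin \o horner p).
Proof.
apply: continuous_compact_integrable; first exact: segment_compact.
by apply: continuous_subspaceT => x; exact: continuous_horner.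
Qed.

Lemma Rintegral_spline (t t1 t2 : R) p q : t < t1 -> t1 < t2 ->
  \int[lebesgue_measure]_(x in [set` `[t, t2]%R]) spline_fun t1 p q x
  = pint t t1 p + pint t1 t2 q.
Proof.
move=> tt1 t1t2.
have eqp : {in [set` `[t, t1[%R]%classic, spline_fun t1 p q =1 horner p}.
  by move=> x; rewrite inE /= in_itv /= /spline_fun => /andP[_ ->].
have eqq : {in [set` `[t1, t2]%R]%classic, spline_fun t1 p q =1 horner q}.
  move=> x; rewrite inE /= in_itv /= /spline_fun => /andP[t1x _].
  by rewrite ltNge t1x.
have ip : lebesgue_measure.-integrable [set` `[t, t1[%R] (EFin \o horner p).
  apply: (integrableS _ _ _ (integrable_poly t t1 p)) => //.
  by move=> x /=; rewrite !in_itv /= => /andP[-> /ltW ->].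
have isp : lebesgue_measure.-integrable [set` `[t, t1[%R]
    (EFin \o spline_fun t1 p q).
  by apply: eq_integrable ip => // x xI /=; rewrite eqp.
have isq : lebesgue_measure.-integrable [set` `[t1, t2]%R]
    (EFin \o spline_fun t1 p q).
  apply: eq_integrable (integrable_poly t1 t2 q) => // x xI /=.
  by rewrite eqq.
have disj : [disjoint [set` `[t, t1[%R] & [set` `[t1, t2]%R]]%classic.
  apply/disj_setPS => x /= [].
  by rewrite !in_itv /= => /andP[_ xt1] /andP[]; rewrite leNgt xt1.
rewrite (@itv_bndbnd_setU _ _ _ (BLeft t1)) ?bnd_simp ?ltW //.
rewrite Rintegral_setU //.
- rewrite (eq_Rintegral lebesgue_measure eqp).
  rewrite (eq_Rintegral lebesgue_measure eqq) Rintegral_poly //.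
  by rewrite Rintegral_itv_bndo_bndc // Rintegral_poly.
- have [/integrableP[mp ltp] /integrableP[mq ltq]] := (isp, isq).
  apply/integrableP; split; first by apply/measurable_funU.
  rewrite ge0_integral_setU //; first exact: lte_add_pinfty.
  apply/measurable_funU => //; split.
    by have /integrableP[] := integrable_abse isp.
  by have /integrableP[] := integrable_abse isq.
Qed.

End PolynomialIntegral.

(** * Higher derivatives of polynomials *)

Section HigherDerivatives.
Variable R : comNzRingType.
Implicit Types (p q : {poly R}) (a b : R).

Lemma derivn_sum (I : Type) (r : seq I) (p : I -> {poly R}) n :
  (\sum_(i <- r) p i)^`(n) = \sum_(i <- r) (p i)^`(n).
Proof. exact: linear_sum. Qed.

Lemma derivn_leibniz n p q :
  (p * q)^`(n) = \sum_(k < n.+1) (p^`(n - k) * q^`(k)) *+ 'C(n, k).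
Proof.
elim: n => [|n IHn] in p q *.
  by rewrite big_ord1 subnn ?derivn0 bin0 mulr1n.
rewrite derivSn derivM derivnD !IHn.
rewrite [RHS]big_ord_recr /= subnn binn mulr1n ?derivn0.
rewrite [X in _ = X + _]big_ord_recl /= bin0 mulr1n ?subn0 ?derivn0.
rewrite [X in X + _ = _]big_ord_recl [X in _ + X = _]big_ord_recr /=.
rewrite !bin0 binn !mulr1n ?subn0 subnn ?derivn0 -!derivSn -!addrA.
congr (_ + _); rewrite addrA; congr (_ + _).
rewrite -big_split /=; apply: eq_bigr => k _.
rewrite /bump leq0n add0n !add1n -derivnS -!derivSn subSS binS mulrnDr.
by rewrite subnSK.
Qed.

Lemma derivn_XsubC_exp a N k :
  (('X - a%:P) ^+ N)^`(k) = ('X - a%:P) ^+ (N - k) *+ N ^_ k.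
Proof.
elim: k => [|k IHk]; first by rewrite subn0 ?derivn0 ffactn0 mulr1n.
rewrite derivnS IHk derivMn deriv_exp derivXsubC mul1r ffactnSr subnS.
by rewrite -mulrnA mulnC.
Qed.

Lemma derivn_mulXsubC a m k q : (k < m)%N ->
  ((('X - a%:P) ^+ m * q)^`(k)).[a] = 0.
Proof.
elim: k m q => [|k IHk] [|m] q // ltkm.
  by rewrite ?derivn0 hornerM horner_exp hornerXsubC subrr expr0n mul0r.
rewrite derivSn derivM deriv_exp derivXsubC mul1r /= mulrnAl -mulrnAr.
by rewrite exprSr -!mulrA -mulrDr IHk.
Qed.

Lemma derivn_comp_affine a b p k :
  (p \Po (a *: 'X + b%:P))^`(k) = a ^+ k *: (p^`(k) \Po (a *: 'X + b%:P)).
Proof.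
elim: k => [|k IHk]; first by rewrite expr0 scale1r.
rewrite !derivnS IHk derivZ deriv_comp derivD derivZ derivX derivC addr0.
by rewrite -scalerAr mulr1 scalerA exprSr.
Qed.

End HigherDerivatives.

(** * Families depending rationally on an index *)

Section RationalFamilies.
Variables (F : fieldType) (I : Type) (e : I -> F).
Implicit Types (s t : I -> F).

(** The denominator must not vanish at any index, so that an identity between
    such families holds at all indices as soon as it holds at a Zariski-dense
    set of them. *)
Definition ratfam s : Prop :=
  exists p q : {poly F}, forall i, q.[e i] != 0 /\ s i * q.[e i] = p.[e i].

Lemma ratfam_poly p : ratfam (fun i => p.[e i]).
Proof. by exists p, 1 => i; rewrite hornerC oner_neq0 mulr1. Qed.

Lemma eq_ratfam s t : s =1 t -> ratfam s -> ratfam t.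
Proof. by move=> st [p [q pq]]; exists p, q => i; rewrite -st. Qed.

Lemma ratfam_const a : ratfam (fun=> a).
Proof. by apply: eq_ratfam (ratfam_poly a%:P) => i; rewrite hornerC. Qed.

Lemma ratfam_id : ratfam e.
Proof. by apply: eq_ratfam (ratfam_poly 'X) => i; rewrite hornerX. Qed.

Lemma ratfamD s t : ratfam s -> ratfam t -> ratfam (fun i => s i + t i).
Proof.
move=> [p [q pq]] [p' [q' pq']]; exists (p * q' + p' * q), (q * q') => i.
have [q0 _] := pq i; have [q'0 _] := pq' i.
rewrite !(hornerD, hornerM) mulf_neq0 //; split=> //.
have [_ <-] := pq i; have [_ <-] := pq' i. ring.
Qed.

Lemma ratfamM s t : ratfam s -> ratfam t -> ratfam (fun i => s i * t i).
Proof.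
move=> [p [q pq]] [p' [q' pq']]; exists (p * p'), (q * q') => i.
have [q0 _] := pq i; have [q'0 _] := pq' i.
rewrite !(hornerD, hornerM) mulf_neq0 //; split=> //.
have [_ <-] := pq i; have [_ <-] := pq' i. ring.
Qed.

Lemma ratfamV s : ratfam s -> (forall i, s i != 0) -> ratfam (fun i => (s i)^-1).
Proof.
move=> [p [q pq]] s0; exists q, p => i; have [q0 <-] := pq i.
by rewrite mulf_neq0 // mulKf.
Qed.

Lemma ratfamN s : ratfam s -> ratfam (fun i => - s i).
Proof.
move=> rs; apply: eq_ratfam (ratfamM (ratfam_const (-1)) rs) => i.
by rewrite mulN1r.
Qed.

Lemma ratfam_sum J (r : seq J) (s : J -> I -> F) :
  (forall j, ratfam (s j)) -> ratfam (fun i => \sum_(j <- r) s j i).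
Proof.
move=> rs; elim: r => [|j r IHr].
  by apply: eq_ratfam (ratfam_const 0) => i; rewrite big_nil.
by apply: eq_ratfam (ratfamD (rs j) IHr) => i; rewrite big_cons.
Qed.

Lemma ratfam_prod J (r : seq J) (s : J -> I -> F) :
  (forall j, ratfam (s j)) -> ratfam (fun i => \prod_(j <- r) s j i).
Proof.
move=> rs; elim: r => [|j r IHr].
  by apply: eq_ratfam (ratfam_const 1) => i; rewrite big_nil.
by apply: eq_ratfam (ratfamM (rs j) IHr) => i; rewrite big_cons.
Qed.

Lemma ratfamX s k : ratfam s -> ratfam (fun i => s i ^+ k).
Proof.
move=> rs; elim: k => [|k IHk].
  by apply: eq_ratfam (ratfam_const 1) => i; rewrite expr0.
by apply: eq_ratfam (ratfamM rs IHk) => i; rewrite exprS.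
Qed.

Definition zariski_dense : Prop :=
  forall p : {poly F}, p != 0 -> exists i, p.[e i] != 0.

Hypothesis dense_e : zariski_dense.

(** A nonzero rational family is nonzero on a dense set, so an identity
    holding wherever another rational family is nonzero holds everywhere. *)
Lemma ratfam_eq0 s t : ratfam s -> ratfam t -> (exists i, t i != 0) ->
  (forall i, t i != 0 -> s i = 0) -> forall i, s i = 0.
Proof.
move=> [p [q pq]] [p' [q' pq']] [i0 ti0] st0 i.
have p'0 : p' != 0.
  apply: contraNneq ti0 => p'0; have [q'0] := pq' i0.
  by rewrite p'0 horner0 => /eqP; rewrite mulf_eq0 (negPf q'0) orbF.
have [p0|p0] := eqVneq p 0.
  have [q0] := pq i; rewrite p0 horner0 => /eqP.
  by rewrite mulf_eq0 (negPf q0) orbF => /eqP.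
have [j] := dense_e (mulf_neq0 p0 p'0).
have [_ pj] := pq j; have [_ p'j] := pq' j.
rewrite hornerM -pj -p'j; have [-> | /st0 ->] := eqVneq (t j) 0.
  by rewrite mul0r mulr0 eqxx.
by rewrite !mul0r eqxx.
Qed.

End RationalFamilies.

Lemma ratfam_meval (F : fieldType) (I : Type) (e : I -> F) k
    (v : I -> 'I_k -> F) (p : mpoly k F) :
  (forall i, ratfam e (v^~ i)) -> ratfam e (fun s => meval (v s) p).
Proof.
move=> rv; apply: (@eq_ratfam _ _ _ _ _ (fun s => esym (mevalE (v s) p))).
apply: ratfam_sum => m; apply: ratfamM; first exact: ratfam_const.
by apply: ratfam_prod => i; apply: ratfamX.
Qed.

Lemma zariski_dense_nat (F : numFieldType) : zariski_dense (fun n => n%:R : F).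
Proof.
move=> p p0; pose s := [seq (i%:R : F) | i <- iota 0 (size p)].
suff /allPn[x /mapP[n _ ->] px] : ~~ all (root p) s by exists n.
apply/negP => rs; suff : (size s < size p)%N by rewrite size_map size_iota ltnn.
by apply: max_poly_roots => //; rewrite map_inj_uniq ?iota_uniq // => ? ? /mulrIn->.
Qed.

Lemma zariski_dense_id (F : numFieldType) : zariski_dense (@id F).
Proof. by move=> p /zariski_dense_nat[n pn]; exists n%:R. Qed.

(** For segments in a projective space from which the poles of a rational map
    are removed. *)
Lemma zariski_dense_sub (F : numFieldType) (I : Type) (e : I -> F) (w : {poly F}) :
  w != 0 -> (forall x, w.[x] != 0 -> exists i, e i = x) -> zariski_dense e.
Proof.
move=> w0 ew p p0; have [x] := zariski_dense_id (mulf_neq0 p0 w0).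
rewrite hornerM mulf_eq0 negb_or => /andP[px /ew[i eix]].
by exists i; rewrite eix.
Qed.

(** * Iterated integration by parts *)

(** The boundary polynomial of [m] successive integrations by parts. *)
Definition bdry (R : nzRingType) m (p f : {poly R}) : {poly R} :=
  \sum_(k < m) (-1) ^+ k *: (p^`(m.-1 - k) * f^`(k)).

Lemma deriv_bdry (R : comNzRingType) m (p f : {poly R}) :
  (bdry m p f)^`() = p^`(m) * f - (-1) ^+ m *: (p * f^`(m)).
Proof.
pose t k := - ((-1) ^+ k *: (p^`(m - k) * f^`(k))).
rewrite /bdry linear_sum /= -(big_mkord xpredT (fun k =>
  ((-1) ^+ k *: (p^`(m.-1 - k) * f^`(k)))^`())).
rewrite (@telescope_sumr_eq _ 0 m t) //; last first.
  move=> k /andP[_ ltkm]; rewrite derivZ derivM -!derivnS /t opprK exprS.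
  rewrite -scalerA scaleN1r opprK addrC scalerDr; congr (_ *: (_ * _) + _ *: (_ * _)).
    by congr derivn; lia.
  by congr derivn; lia.
by rewrite /t subnn subn0 expr0 scale1r opprK addrC.
Qed.

Lemma pint_parts (R : realType) (a b : R) m (p f : {poly R}) :
  pint a b (p^`(m) * f) =
  (bdry m p f).[b] - (bdry m p f).[a] + (-1) ^+ m * pint a b (p * f^`(m)).
Proof.
rewrite -pint_deriv deriv_bdry linearB linearZ /= /GRing.scale /=.
by rewrite subrK.
Qed.

Lemma bdryDr (R : nzRingType) m (p f g : {poly R}) :
  bdry m p (f + g) = bdry m p f + bdry m p g.
Proof.
rewrite /bdry -big_split; apply: eq_bigr => k _.
by rewrite derivnD mulrDr scalerDr.
Qed.

Lemma bdry_mulXsubC_r (R : comNzRingType) m (p f : {poly R}) a :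
  (bdry m p (('X - a%:P) ^+ m * f)).[a] = 0.
Proof.
rewrite horner_sum big1 // => k _.
by rewrite hornerZ hornerM derivn_mulXsubC // !mulr0.
Qed.

Lemma bdry_mulXsubC_l (R : comNzRingType) m (p f : {poly R}) a :
  (bdry m (('X - a%:P) ^+ m * p) f).[a] = 0.
Proof.
rewrite horner_sum big1 // => -[k ltkm] _ /=.
by rewrite hornerZ hornerM derivn_mulXsubC ?mul0r ?mulr0 //; lia.
Qed.

(** * Iterated antiderivatives of the Jacobi polynomials *)

Section JacobiPrimitive.
Variable (R : realType) (c : nat).
Let W : {poly R} := ('X - 1%:P) * ('X - (-1)%:P).

(** A multiple of the Legendre polynomial of degree [N]. The factor makes its
    derivative of order [c.+1] equal to the Jacobi polynomial of degree
    [N - c.+1]. *)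
Definition primJ N : {poly R} :=
  (2 ^+ c.+1 / (2 ^+ N * (N + c.+1)`!%:R)) *: (W ^+ N)^`(N).

(** By the Leibniz rule both sides are combinations of the same products
    [('X - 1) ^+ s * ('X + 1) ^+ (m - s)]; the terms of the derivative with
    [k < a] or [m + a < k] vanish, and the others match with [k = s + a]. *)
Lemma derivn_primJ m : (primJ (m + c.+1))^`(c.+1) = jacobi R c.+1 c.+1 m.
Proof.
set a := c.+1; set N := (m + a)%N.
rewrite /primJ derivnZ /derivn -iterD -/(derivn _ _) exprMn derivn_leibniz.
rewrite -(big_mkord xpredT (fun k => ((('X - 1%:P) ^+ N)^`(a + N - k)
   * (('X - (-1)%:P) ^+ N)^`(k)) *+ 'C(a + N, k))).
rewrite (big_cat_nat (n := a)) //=; last lia.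
rewrite big_nat big1 ?add0r => [|k /andP[_ ltka]]; last first.
  by rewrite derivn_XsubC_exp ffact_small ?mulr0n ?mul0r ?mul0rn //; lia.
rewrite (big_cat_nat (n := m.+1 + a)) //=; [|lia|lia].
rewrite [X in _ + X]big_nat [X in _ + X]big1 ?addr0 => [|k /andP[lek _]]; last first.
  rewrite [X in _ * X]derivn_XsubC_exp ffact_small ?mulr0n ?mulr0 ?mul0rn //; lia.
rewrite -{1}[a]add0n big_addn addnK big_mkord scaler_sumr /jacobi -/a.
apply: eq_bigr => -[s /= ltsm] _; rewrite !derivn_XsubC_exp.
have -> : (N - (a + N - (s + a)) = s)%N by lia.
have -> : (N - (s + a) = m - s)%N by lia.
have -> : (a + N - (s + a) = N - s)%N by lia.
rewrite polyCN opprK polyC1 [_ *+ _ * _]mulrnAl.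
rewrite [X in X *+ _ *+ _]mulrnAr -!mulrnA -[_ *+ (_ * _)%N]scaler_nat scalerA.
congr (_ *: _).
(* Both sides become a product of factorials once multiplied by
   [s! (m - s)! (s + a)! (N - s)!]. *)
have key : (N ^_ (s + a) * (N ^_ (N - s) * 'C(a + N, s + a))
            = (N + a)`! * ('C(N, m - s) * 'C(N, s)))%N.
  have f1 : (N ^_ (N - s) * s`! = N`!)%N.
    by rewrite -[X in (_ * X`!)%N](_ : N - (N - s) = s)%N ?ffact_fact //; lia.
  have f2 : (N ^_ (s + a) * (m - s)`! = N`!)%N.
    by rewrite -[(m - s)%N](_ : N - (s + a) = _)%N ?ffact_fact //; lia.
  have f3 : ('C(a + N, s + a) * ((s + a)`! * (N - s)`!) = (N + a)`!)%N.
    rewrite -[(N - s)%N](_ : a + N - (s + a) = _)%N ?bin_fact 1?addnC //; lia.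
  have f4 : ('C(N, m - s) * ((m - s)`! * (s + a)`!) = N`!)%N.
    by rewrite -[(s + a)%N](_ : N - (m - s) = _)%N ?bin_fact //; lia.
  have f5 : ('C(N, s) * (s`! * (N - s)`!) = N`!)%N by apply: bin_fact; lia.
  move: (fact_gt0 s) (fact_gt0 (m - s)).
  move: (fact_gt0 (s + a)) (fact_gt0 (N - s)) f1 f2 f3 f4 f5.
  move: (N`!) ((N + a)`!) (s`!) ((m - s)`!) ((s + a)`!) ((N - s)`!).
  move: (N ^_ (s + a)) (N ^_ (N - s)) ('C(a + N, s + a)) ('C(N, m - s)) ('C(N, s)).
  move=> x2 x1 x3 y1 y2 u v p1 p2 p3 p4 p3_gt0 p4_gt0 f1 f2 f3 f4 f5 p1_gt0 p2_gt0.
  apply/eqP; rewrite -(eqn_pmul2r p1_gt0) -(eqn_pmul2r p2_gt0).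
  rewrite -(eqn_pmul2r p3_gt0) -(eqn_pmul2r p4_gt0); apply/eqP.
  transitivity (u * (u * v))%N; first by rewrite -{1}f2 -f1 -f3; ring.
  by rewrite -{1}f4 -f5; ring.
rewrite key.
rewrite natrM /N exprD; field.
by rewrite !expf_neq0 ?pnatr_eq0 -?lt0n ?fact_gt0.
Qed.

Lemma derivn_primJ_small N : (N < c.+1)%N -> (primJ N)^`(c.+1) = 0.
Proof.
move=> ltNc; rewrite /primJ derivnZ /derivn -iterD -/(derivn _ _).
rewrite derivn_poly0 ?scaler0 //.
apply: (leq_trans (size_exp_leq _ _)).
have : (size W <= 3)%N by apply: leq_trans (size_polyMleq _ _) _; rewrite !size_XsubC.
nia.
Qed.

Lemma primJ_parity N :
  primJ N \Po (-1 *: 'X + 0%:P) = (-1) ^+ N *: primJ N.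
Proof.
have WW : W \Po (-1 *: 'X + 0%:P) = W.
  rewrite /W rmorphM /= !comp_polyB !comp_polyC !comp_polyX scaleN1r addr0.
  by rewrite polyCN polyC1; ring.
rewrite /primJ comp_polyZ [RHS]scalerA [in RHS]mulrC -[RHS]scalerA; congr (_ *: _).
have E : (W ^+ N)^`(N) = (-1) ^+ N *: ((W ^+ N)^`(N) \Po (-1 *: 'X + 0%:P)).
  by rewrite -derivn_comp_affine rmorphXn /= WW.
rewrite [in RHS]E.
by rewrite scalerA -exprD -signr_odd oddD addbb scale1r.
Qed.

Lemma derivn_primJ_left N k :
  (primJ N)^`(k).[-1] =
  2 ^+ c.+1 / (2 ^+ N * (N + c.+1)`!%:R)
    * ((N + k)`! * N ^_ k)%:R / k`!%:R * (-2) ^+ (N - k).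
Proof.
rewrite /primJ derivnZ /derivn -iterD -/(derivn _ _) exprMn hornerZ (addnC k).
rewrite derivn_leibniz horner_sum.
(* Only the term that differentiates [('X + 1) ^+ N] exactly [N] times
   survives at [-1]. *)
have ltN : (N < (N + k).+1)%N by rewrite ltnS leq_addr.
rewrite (bigD1 (Ordinal ltN)) //= big1 ?addr0 => [|[j /= ltj] neqjN]; last first.
  rewrite hornerMn hornerM !derivn_XsubC_exp !hornerMn !horner_exp !hornerXsubC subrr.
  have : (j != N)%N by apply: contraNneq neqjN => eqjN; apply/eqP/val_inj.
  rewrite neq_ltn => /orP[ltjN|ltNj]; last by rewrite (@ffact_small N j) // mulr0n mulr0 mul0rn.
  by rewrite expr0n subn_eq0 leqNgt ltjN /= mul0rn mulr0 mul0rn.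
rewrite addKn hornerMn hornerM !derivn_XsubC_exp !hornerMn !horner_exp !hornerXsubC subrr.
rewrite subnn expr0 ffactnn -[X in _ = X]mulrA -[X in _ = X]mulrA; congr (_ * _).
have kf : (k`!%:R : R) != 0 by rewrite pnatr_eq0 -lt0n fact_gt0.
have -> : (-1 - 1 : R) = -2 by ring.
have bf : ('C(N + k, N) * (N`! * k`!) = (N + k)`!)%N.
  by rewrite -{2}(addKn N k) bin_fact ?leq_addr.
rewrite -bf !natrM -[_ *+ N ^_ k]mulr_natr -[_ *+ N`!]mulr_natr -[_ *+ 'C(_, _)]mulr_natr.
by field.
Qed.

Lemma ratfam_shift b : ratfam (fun n => n%:R : R) (fun n => (n + b)%:R).
Proof.
apply: eq_ratfam (ratfamD (ratfam_id _) (ratfam_const _ b%:R)) => n.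
by rewrite natrD.
Qed.

Lemma ratfam_ffact b k : ratfam (fun n => n%:R : R) (fun n => ((n + b) ^_ k)%:R).
Proof.
elim: k => [|k IHk]; first by apply: eq_ratfam (ratfam_const _ 1) => n.
apply: eq_ratfam (ratfamM IHk (ratfamD (ratfam_shift b) (ratfam_const _ (- k%:R)))).
move=> n; rewrite ffactnSr; have [lek|ltk] := leqP k (n + b).
  by rewrite natrM natrB.
by rewrite ffact_small // mul0n mul0r.
Qed.

Lemma ratfam_fact_ratio b k m :
  ratfam (fun n => n%:R : R) (fun n => (n + b + k)`!%:R / (n + b + m)`!%:R).
Proof.
have f0 n : (n`!%:R : R) != 0 by rewrite pnatr_eq0 -lt0n fact_gt0.
have rk i : ratfam (fun n => n%:R : R) (fun n => (n + b + i)`!%:R / (n + b)`!%:R).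
  elim: i => [|i IHi].
    by apply: eq_ratfam (ratfam_const _ 1) => n; rewrite addn0 divff.
  apply: eq_ratfam (ratfamM IHi (ratfam_shift (b + i).+1)) => n.
  by rewrite !addnS addnA factS natrM mulrAC [in RHS](mulrC _.+1%:R).
have nz n : ((n + b + m)`!%:R / (n + b)`!%:R : R) != 0.
  by rewrite mulf_neq0 ?invr_eq0.
apply: eq_ratfam (ratfamM (rk k) (ratfamV (rk m) nz)) => n.
by rewrite invf_div mulrA divfK.
Qed.

(** Up to the sign, the jets of the primitives at the left end point are
    rational in the degree. The sign is the only obstacle to continuing
    identities from large degrees to small ones. *)
Lemma ratfam_primJ b k :
  ratfam (fun n => n%:R) (fun n => (-1) ^+ n * (primJ (n + b))^`(k).[-1]).
Proof.
pose K : R := 2 ^+ c.+1 * (-1) ^+ b / (k`!%:R * (-2) ^+ k).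
apply: eq_ratfam (ratfamM (ratfam_const _ K)
  (ratfamM (ratfam_fact_ratio b k c.+1) (ratfam_ffact b k))) => n.
have f0 i : (i`!%:R : R) != 0 by rewrite pnatr_eq0 -lt0n fact_gt0.
rewrite derivn_primJ_left natrM /K.
have [lek|ltk] := leqP k (n + b); last first.
  by rewrite ffact_small // !(mulr0, mul0r).
have n2 : (2 : R) != 0 by rewrite pnatr_eq0.
have m2 : (-2 : R) != 0 by rewrite oppr_eq0.
rewrite expfB_cond ?(negPf m2) //.
have -> : (-2 : R) ^+ (n + b) = (-1) ^+ n * (-1) ^+ b * 2 ^+ (n + b).
  by rewrite -exprD -exprMn mulN1r.
have s1 : ((-1) ^+ n * (-1) ^+ n : R) = 1 by rewrite -exprMn mulrNN mulr1 expr1n.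
rewrite -[LHS]mul1r -[X in X * _ = _]s1; field.
by rewrite !f0 !expf_neq0.
Qed.

(** The primitives are orthogonal to the polynomials of smaller degree, since
    [W ^+ N] vanishes to order [N] at both end points. *)
Lemma primJ_orth N (f : {poly R}) : (size f <= N)%N ->
  pint (-1) 1 (primJ N * f) = 0.
Proof.
move=> szf; rewrite /primJ -scalerAl linearZ /= pint_parts (derivn_poly0 szf).
rewrite mulr0 linear0 mulr0 addr0 exprMn bdry_mulXsubC_l.
rewrite [X in bdry _ X]mulrC bdry_mulXsubC_l.
by rewrite subrr scaler0.
Qed.

End JacobiPrimitive.

(** * Orthogonality to all polynomials of smaller degree *)

Lemma jacobi_lead (R : numFieldType) a b n : (jacobi R a b n)`_n != 0.
Proof.
rewrite /jacobi coef_sum gt_eqF // big_ord_recl /= ltr_pwDl //.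
  rewrite coefZ expr0 mul1r subn0 bin0 muln1 mulr_gt0 //.
    by rewrite divr_gt0 ?exprn_gt0 ?ltr0n // bin_gt0 leq_addr.
  have -> : ('X + 1 : {poly R}) = 'X - (-1)%:P by rewrite polyCN opprK polyC1.
  have := lead_coef_exp ('X - (-1)%:P : {poly R}) n.
  by rewrite lead_coefXsubC expr1n /lead_coef size_exp_XsubC /= => ->; exact: ltr01.
apply: sumr_ge0 => -[s /= ltsn] _; rewrite coefZ mulr_ge0 ?divr_ge0 ?exprn_ge0 ?ler0n //.
set p := _ * _; have [mp szp] : p \is monic /\ size p = n.+1.
  rewrite /p; have -> : ('X - 1 : {poly R}) = 'X - 1%:P by rewrite polyC1.
  have -> : ('X + 1 : {poly R}) = 'X - (-1)%:P by rewrite polyCN opprK polyC1.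
  rewrite monicMl ?monic_exp ?monicXsubC //; split=> //.
  rewrite size_Mmonic ?monic_exp ?monicXsubC ?expf_neq0 ?polyXsubC_eq0 //.
  rewrite !size_exp_XsubC; move: ltsn; rewrite /bump; lia.
by have := monicP mp; rewrite /lead_coef szp /= => ->; exact: ler01.
Qed.

Definition is_linear_form (F : fieldType) (L : {poly F} -> F) :=
  forall c q q', L (c *: q + q') = c * L q + L q'.

Lemma linear_form0 (F : fieldType) (L : {poly F} -> F) :
  is_linear_form L -> L 0 = 0.
Proof.
by move=> linL; have := linL (-1) 0 0; rewrite scaleN1r oppr0 addr0 mulN1r addNr.
Qed.

Lemma linear_formZ (F : fieldType) (L : {poly F} -> F) c q :
  is_linear_form L -> L (c *: q) = c * L q.
Proof. by move=> linL; rewrite -[c *: q]addr0 linL linear_form0 // addr0. Qed.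

(** Pairwise orthogonal polynomials are orthogonal to everything of smaller
    degree only where those of smaller degree keep their degree. Since this
    is so at one index, the conclusion extends to all indices by
    rationality. *)
Lemma orth_smaller_degree (F : fieldType) (I : Type) (e : I -> F)
    (L : I -> {poly F} -> F) (q : nat -> I -> {poly F}) :
  zariski_dense e -> (forall i, is_linear_form (L i)) ->
  (forall p, ratfam e (L^~ p)) ->
  (forall m i, (size (q m i) <= m.+1)%N) ->
  (forall m k, ratfam e (fun i => (q m i)`_k)) ->
  (forall m k i, m <> k -> L i (q m i * q k i) = 0) ->
  (exists i, forall m, (q m i)`_m != 0) ->
  forall i n (f : {poly F}), (size f <= n)%N -> L i (q n i * f) = 0.
Proof.
move=> dense_e linL ratL szq ratq orthq [i0 qi0] i n f szf.
have L0 i' : L i' 0 = 0 by exact: linear_form0.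
have Lsum i' N (a : nat -> F) (p : nat -> {poly F}) :
    L i' (\sum_(k < N) a k *: p k) = \sum_(k < N) a k * L i' (p k).
  elim: N => [|N IHN]; first by rewrite !big_ord0 L0.
  by rewrite !big_ord_recr /= addrC linL IHN addrC.
apply: (@ratfam_eq0 _ _ _ dense_e (fun i => L i (q n i * f))
  (fun i => \prod_(k <- iota 0 n) (q k i)`_k)).
- apply: (@eq_ratfam _ _ _ (fun i => \sum_(k < n.+1) (q n i)`_k * L i ('X^k * f))).
    move=> i'; rewrite -(Lsum i' n.+1 (nth 0 (q n i')) (fun k => 'X^k * f)).
    have qE : q n i' = \sum_(k < n.+1) (q n i')`_k *: 'X^k.
      rewrite -poly_def; apply/polyP => k; rewrite coef_poly.
      case: ltnP => // lenk; rewrite nth_default //.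
      exact: leq_trans (szq _ _) lenk.
    rewrite {2}qE mulr_suml; congr (L i' _); apply: eq_bigr => k _.
    by rewrite scalerAl.
  by apply: ratfam_sum => k; apply: ratfamM.
- exact: ratfam_prod.
- by exists i0; rewrite prodf_seq_neq0; apply/allP => k _ /=.
move=> i' nz.
suff H k (g : {poly F}) : (k <= n)%N -> (size g <= k)%N -> L i' (q n i' * g) = 0.
  exact: (H n).
elim: k g => [|k IHk] g lekn szg.
  by move: szg; rewrite size_poly_leq0 => /eqP ->; rewrite mulr0 L0.
have nzk : (q k i')`_k != 0.
  move: nz; rewrite prodf_seq_neq0 => /allP/(_ k).
  by rewrite mem_iota add0n lekn => /(_ isT).
pose a := g`_k / (q k i')`_k.
have -> : q n i' * g = a *: (q n i' * q k i') + q n i' * (g - a *: q k i').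
  by rewrite mulrBr -scalerAr addrC subrK.
rewrite linL orthq ?mulr0 ?add0r; last by lia.
apply: IHk; first exact: ltnW.
apply/leq_sizeP => j; rewrite leq_eqVlt => /predU1P[<-|ltkj].
  by rewrite coefB coefZ divfK // subrr.
have szqj : (size (q k i') <= j)%N by exact: leq_trans (szq _ _) ltkj.
have szgj : (size g <= j)%N by exact: leq_trans szg ltkj.
by rewrite coefB coefZ !nth_default // mulr0 subr0.
Qed.

Lemma size_derivn_le (R : nzRingType) (p : {poly R}) m n :
  (size p <= n + m)%N -> (size p^`(m) <= n)%N.
Proof.
move=> szp; apply/leq_sizeP => i leni; rewrite coef_derivn nth_default ?mul0rn //.
by apply: leq_trans szp _; rewrite addnC leq_add2l.
Qed.

(** * The boundary forms at the two end points *)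

Section BoundaryForms.
Variables (R : realType) (c : nat).
Local Notation a := c.+1.
Implicit Types (l r : params R c) (f P : {poly R}) (u : hcoords R c).

(** The integral against [W_M]; on multiples of [(1 - X) ^+ a] the masses at
    the right end point are invisible and it becomes the integral against
    [W_Q]. *)
Definition Wform l r f : R := pint (-1) 1 f
  + \sum_(i < a) l i * (-1) ^+ i * f^`(i).[-1] + \sum_(i < a) r i * f^`(i).[1].

Lemma Wform_linear l r : is_linear_form (Wform l r).
Proof.
move=> k f g.
have S (w : 'I_a -> R) x : \sum_(i < a) w i * (k *: f + g)^`(i).[x] =
    k * (\sum_(i < a) w i * f^`(i).[x]) + \sum_(i < a) w i * g^`(i).[x].
  rewrite mulr_sumr -big_split /=; apply: eq_bigr => i _.
  by rewrite derivnD derivnZ hornerD hornerZ; ring.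
by rewrite /Wform !S linearP /= /GRing.scale /=; ring.
Qed.

Lemma WM_intE l r f : WM_int l r f = Wform l r f.
Proof.
rewrite /WM_int Rintegral_poly ?gtrN // /Wform; congr (_ + _ + _).
  by apply: eq_bigr => i _; rewrite /delta_int mulrA.
apply: eq_bigr => i _; rewrite /delta_int opprK.
transitivity ((-1) ^+ i * (-1) ^+ i * (r i * f^`(i).[1])); first by ring.
by rewrite -exprMn mulrNN mulr1 expr1n mul1r.
Qed.

Lemma WQ_intE l r f : WQ_int l f = Wform l r ((1 - 'X) ^+ a * f).
Proof.
rewrite /WQ_int Rintegral_poly ?gtrN // /Wform -[LHS]addr0; congr (_ + _ + _).
  by apply: eq_bigr => i _; rewrite /delta_int mulrA.
rewrite big1 // => i _.
have -> : (1 - 'X : {poly R}) = (-1) *: ('X - 1%:P).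
  by rewrite scaleN1r opprB polyC1.
by rewrite exprZn -scalerAl derivnZ hornerZ derivn_mulXsubC // !mulr0.
Qed.

Lemma WQ_is_linear l : is_linear_form (WQ_int l).
Proof.
by move=> k f g; rewrite !(WQ_intE _ (fun=> 0)) mulrDr -scalerAr Wform_linear.
Qed.

(** What integration by parts leaves at the left and at the right end point of
    the integral of [P^`(a) * f] against [W_M]. *)
Definition Lform P l f : R :=
  \sum_(i < a) l i * (-1) ^+ i * (P^`(a) * f)^`(i).[-1] - (bdry a P f).[-1].

Definition Rform P r f : R :=
  \sum_(i < a) r i * (P^`(a) * f)^`(i).[1] + (bdry a P f).[1].

Lemma Wform_parts P l r f : Wform l r (P^`(a) * f) =
  Lform P l f + Rform P r f + (-1) ^+ a * pint (-1) 1 (P * f^`(a)).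
Proof. by rewrite /Wform pint_parts /Lform /Rform; ring. Qed.

Lemma LformD P l f g : Lform P l (f + g) = Lform P l f + Lform P l g.
Proof.
rewrite /Lform bdryDr hornerD mulrDr opprD addrACA -big_split; congr (_ + _).
by apply: eq_bigr => i _; rewrite derivnD hornerD mulrDr.
Qed.

Lemma Lform_local P l f : Lform P l (('X - (-1)%:P) ^+ a * f) = 0.
Proof.
rewrite /Lform bdry_mulXsubC_r subr0 big1 // => i _.
by rewrite mulrCA derivn_mulXsubC // !mulr0.
Qed.

Lemma Rform_local P r f : Rform P r (('X - 1%:P) ^+ a * f) = 0.
Proof.
rewrite /Rform bdry_mulXsubC_r addr0 big1 // => i _.
by rewrite mulrCA derivn_mulXsubC // !mulr0.
Qed.

(** The left form sees only the jet of [f] at [-1], and modulo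
    [(X + 1) ^+ a] every polynomial is a multiple of [(1 - X) ^+ a] by a
    polynomial of degree at most [c]. *)
Lemma Lform_eq0 P l n : (a <= n)%N ->
  (forall f, (size f <= n)%N -> pint (-1) 1 (P * f) = 0) ->
  (forall f, (size f <= n)%N -> WQ_int l (P^`(a) * f) = 0) ->
  forall f, Lform P l f = 0.
Proof.
move=> lean orthP orthW f.
have szA : size (('X - 1%:P : {poly R}) ^+ a) = a.+1 by rewrite size_exp_XsubC.
have cop : coprimep (('X - 1%:P) ^+ a : {poly R}) (('X - (-1)%:P) ^+ a).
  apply: coprimep_expl; apply: coprimep_expr; rewrite coprimep_XsubC root_XsubC.
  by rewrite lt_eqF // gtrN.
have /Bezout_coprimepP[[u v] /= uv1] := cop.
have [w [k [szk fE]]] : exists w k : {poly R}, (size k <= a)%N /\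
    f = ('X - 1%:P) ^+ a * k + ('X - (-1)%:P) ^+ a * w.
  have /eqpf_eq[k k0 kE] := uv1.
  pose g := k^-1 *: (u * f); set B := ('X - (-1)%:P) ^+ a in cop uv1 kE *.
  have B0 : B != 0 by rewrite expf_neq0 // polyXsubC_eq0.
  exists (('X - 1%:P) ^+ a * (g %/ B) + k^-1 *: (v * f)), (g %% B); split.
    by have := ltn_modpN0 g B0; rewrite [size B]size_exp_XsubC.
  have gE := divp_eq g B.
  transitivity (k^-1 *: (k%:P * f)); first by rewrite mul_polyC scalerK.
  rewrite -alg_polyC -kE mulrDl scalerDr.
  transitivity (('X - 1%:P) ^+ a * g + B * (k^-1 *: (v * f))).
    by rewrite /g -!scalerAr; congr (_ *: _ + _ *: _); ring.
  by rewrite {1}gE; ring.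
rewrite fE LformD Lform_local addr0.
have szf : (size (('X - 1%:P) ^+ a * k)%R <= n + a)%N.
  apply: leq_trans (size_polyMleq _ _) _; rewrite szA addSn [X in (X <= _)%N]/= addnC.
  by rewrite leq_add // (leq_trans szk).
have := Wform_parts P l (fun=> 0) (('X - 1%:P) ^+ a * k).
rewrite Rform_local addr0 orthP ?size_derivn_le //.
rewrite mulr0 addr0 => <-; rewrite mulrCA.
have -> : (('X - 1%:P) ^+ a : {poly R}) = (-1) ^+ a *: (1 - 'X) ^+ a.
  by rewrite -exprZn scaleN1r opprB polyC1.
rewrite -scalerAl (linear_formZ _ _ (Wform_linear _ _)) -WQ_intE orthW ?mulr0 //.
exact: leq_trans szk lean.
Qed.

(** A derivative of order [i] picks up the sign [(-1) ^+ i], which is the one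
    that distinguishes the masses of the two end points in [W_M]; the boundary
    terms of integration by parts change sign because the end points are
    exchanged. *)
Lemma Lform_reflect P l f :
  let rho p := p \Po (-1 *: 'X + 0%:P) in
  Lform (rho P) l (rho f) = (-1) ^+ a * Rform P l f.
Proof.
move=> rho.
have rhoM p q : rho p * rho q = rho (p * q) by rewrite /rho comp_polyM.
have rhoD p k : (rho p)^`(k) = (-1) ^+ k *: rho p^`(k) by exact: derivn_comp_affine.
have rho1 p : (rho p).[-1] = p.[1].
  by rewrite /rho horner_comp !hornerE mulrNN mulr1.
rewrite /Lform /Rform mulrDr; congr (_ + _).
  rewrite mulr_sumr; apply: eq_bigr => i _.
  rewrite rhoD -scalerAl rhoM derivnZ rhoD !hornerZ rho1.
  rewrite [(-1) ^+ a * ((-1) ^+ i * _)]mulrCA !mulrA; congr (_ * _).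
  by rewrite [_ * (-1) ^+ a]mulrC -!mulrA -exprMn mulrNN mulr1 expr1n mulr1.
rewrite /bdry !horner_sum mulr_sumr -sumrN; apply: eq_bigr => -[k /= ltka] _.
rewrite !rhoD -scalerAl -scalerAr rhoM !hornerZ rho1.
have -> : (-1 : R) ^+ a = - ((-1) ^+ (c - k) * (-1) ^+ k).
  by rewrite -exprD subnK // exprS mulN1r.
by rewrite !mulNr; congr (- _); ring.
Qed.

Lemma ratfam_Lform I (e : I -> R) (s : I -> R) (P : I -> {poly R}) (l : I -> params R c) f :
  (forall k, ratfam e (fun i => s i * (P i)^`(k).[-1])) ->
  (forall k, ratfam e (l^~ k)) ->
  ratfam e (fun i => s i * Lform (P i) (l i) f).
Proof.
move=> ratP ratl.
have ratM m k : ratfam e (fun i => s i * ((P i)^`(m) * f)^`(k).[-1]).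
  apply: (@eq_ratfam _ _ _ (fun i => \sum_(t < k.+1)
    (s i * (P i)^`(k - t + m).[-1]) * (f^`(t).[-1] *+ 'C(k, t)))).
    move=> i; rewrite derivn_leibniz horner_sum mulr_sumr; apply: eq_bigr => t _.
    by rewrite hornerMn hornerM /derivn -iterD !mulrnAr mulrA.
  by apply: ratfam_sum => t; apply: ratfamM => //; apply: ratfam_const.
apply: (@eq_ratfam _ _ _ (fun i =>
  \sum_(k < a) (l i k * ((-1) ^+ k * (s i * ((P i)^`(a) * f)^`(k).[-1])))
  - \sum_(k < a) (-1) ^+ k * (s i * (P i)^`(c - k).[-1] * f^`(k).[-1]))).
  move=> i; rewrite /Lform mulrBr !mulr_sumr horner_sum mulr_sumr; congr (_ - _).
    by apply: eq_bigr => k _; ring.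
  by apply: eq_bigr => k _; rewrite hornerZ hornerM; ring.
apply: ratfamD.
  apply: ratfam_sum => k; apply: ratfamM => //.
  by apply: ratfamM => //; exact: ratfam_const.
apply: ratfamN; apply: ratfam_sum => k; apply: ratfamM; first exact: ratfam_const.
by apply: ratfamM => //; exact: ratfam_const.
Qed.

End BoundaryForms.

(** * Gaussian quadrature over a field *)

Section GaussRule.
Variable F : fieldType.
Implicit Types (p q f h : {poly F}) (xs : seq F) (x : F).

Lemma uniq_of_deriv_neq0 xs (k : F) p : p = k *: \prod_(x <- xs) ('X - x%:P) ->
  (forall x, x \in xs -> p^`().[x] != 0) -> uniq xs.
Proof.
move=> -> simple; apply: contraT => dup.
have [x xin [q qE]] : exists2 x, x \in xs &
    exists q, \prod_(y <- xs) ('X - y%:P) = ('X - x%:P) ^+ 2 * q.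
  move: dup {simple}; elim: xs => //= y s IHs; rewrite negb_and negbK.
  have [ys _|ys /= /IHs[x xs [q qE]]] := boolP (y \in s).
    exists y; first exact: mem_head.
    exists (\prod_(z <- rem y s) ('X - z%:P)).
    by rewrite big_cons (perm_big _ (perm_to_rem ys)) big_cons mulrA -expr2.
  exists x; first by rewrite inE xs orbT.
  by exists (('X - y%:P) * q); rewrite big_cons qE mulrCA.
apply: contraNT (simple x xin) => _; rewrite qE derivZ derivM deriv_exp derivXsubC.
by rewrite mul1r expr1 expr2 !(hornerXsubC, hornerZ, hornerD, hornerM, hornerMn)
  subrr !(mul0r, mul0rn, addr0, mulr0).
Qed.

Variables (p : {poly F}) (xs : seq F) (k : F).
Hypothesis pE : p = k *: \prod_(x <- xs) ('X - x%:P).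
Hypothesis k_neq0 : k != 0.
Hypothesis simple : forall x, x \in xs -> p^`().[x] != 0.

Let n := size xs.
Let p_neq0 : p != 0.
Proof. by rewrite pE scaler_eq0 (negPf k_neq0) /= prodf_seq_neq0;
  apply/allP => x _; rewrite polyXsubC_eq0. Qed.

Let size_p : size p = n.+1.
Proof. by rewrite pE size_scale // size_prod_XsubC. Qed.

Let root_p x : root p x = (x \in xs).
Proof. by rewrite pE rootZ // root_prod_XsubC. Qed.

Definition lagrange_at x : {poly F} := (p^`().[x])^-1 *: (p %/ ('X - x%:P)).

Let divpXsubCK x : x \in xs -> p %/ ('X - x%:P) * ('X - x%:P) = p.
Proof. by rewrite -root_p root_factor_theorem => /divpK. Qed.

Lemma lagrange_atE x y : x \in xs -> y \in xs -> (lagrange_at x).[y] = (x == y)%:R.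
Proof.
move=> xin yin; rewrite hornerZ; have pK := divpXsubCK xin.
have [<-|neqxy] := eqVneq x y.
  rewrite -{1}pK derivM derivXsubC mulr1 !hornerE subrr mulr0 add0r.
  rewrite mulVf //; have := simple xin.
  by rewrite -{1}pK derivM derivXsubC mulr1 !hornerE subrr mulr0 add0r.
have : p.[y] == 0 by rewrite -/(root p y) root_p.
rewrite -{1}pK hornerM hornerXsubC mulf_eq0 subr_eq0 [y == x]eq_sym (negPf neqxy) orbF.
by move=> /eqP ->; rewrite mulr0.
Qed.

Lemma size_lagrange_at x : (size (lagrange_at x) <= n)%N.
Proof.
apply: leq_trans (size_scale_leq _ _) _.
by rewrite size_divp ?polyXsubC_eq0 // size_XsubC size_p subn1.
Qed.

Variable L : {poly F} -> F.
Hypothesis linL : is_linear_form L.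

Let L0 : L 0 = 0.
Proof. exact: linear_form0. Qed.

Let Lsum (s : seq F) (c : F -> F) (q : F -> {poly F}) :
  L (\sum_(x <- s) c x *: q x) = \sum_(x <- s) c x * L (q x).
Proof.
by elim: s => [|x s IHs]; rewrite ?big_nil ?L0 // !big_cons linL IHs.
Qed.

(** The difference of [h] and its interpolation polynomial is a multiple of [p]. *)
Lemma interpolatory m : (forall f, (size f <= m)%N -> L (p * f) = 0) ->
  forall h, (size h <= n + m)%N -> L h = \sum_(x <- xs) h.[x] * L (lagrange_at x).
Proof.
move=> Lp h szh; rewrite -Lsum; set g := \sum_(x <- xs) _.
have uxs : uniq xs by exact: uniq_of_deriv_neq0 pE simple.
have gE y : y \in xs -> g.[y] = h.[y].
  move=> yin; rewrite horner_sum (bigD1_seq y) //= big_seq_cond big1 ?addr0.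
    by rewrite hornerZ lagrange_atE // eqxx mulr1.
  by move=> x /andP[xin neqxy]; rewrite hornerZ lagrange_atE // (negPf neqxy) mulr0.
have szg : (size g <= n + m)%N.
  rewrite /g big_seq; apply: (leq_trans (size_sum _ _ _)).
  apply/bigmax_leqP_seq => x xin _; apply: leq_trans (size_scale_leq _ _) _.
  exact: leq_trans (size_lagrange_at x) (leq_addr _ _).
have : p %| h - g.
  rewrite pE dvdpZl //; apply: uniq_roots_dvdp; last by rewrite uniq_rootsE.
  by apply/allP => y yin; rewrite rootE hornerD hornerN gE // subrr.
move=> /dvdpP[q hgE].
have -> : h = 1 *: (p * q) + g by rewrite scale1r [p * q]mulrC -hgE subrK.
rewrite linL Lp ?mulr0 ?add0r //.
have [->|q0] := eqVneq q 0; first by rewrite size_poly0.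
have : (size (h - g)%R <= n + m)%N.
  by rewrite (leq_trans (size_polyD _ _)) // size_polyN geq_max szh szg.
by rewrite hgE size_mul // size_p addnS addnC leq_add2l.
Qed.

(** The Christoffel form of the weights: the quotient [p %/ ('X - x%:P)] pairs
    with [q] in two ways, through the value of [q] at [x] and through the
    leading coefficients. *)
Lemma christoffel_weight (q : {poly F}) x : x \in xs ->
  q`_n.-1 != 0 -> (size q <= n)%N -> q.[x] != 0 ->
  (forall f, (size f <= n)%N -> L (p * f) = 0) ->
  (forall f, (size f <= n.-1)%N -> L (q * f) = 0) ->
  L (lagrange_at x) = p`_n / q`_n.-1 * L (q ^+ 2) / (p^`().[x] * q.[x]).
Proof.
move=> xin qn0 szq qx0 Lp Lq; set g := p %/ ('X - x%:P).
have n_gt0 : (0 < n)%N by rewrite /n; case: (xs) xin.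
have gK : g * ('X - x%:P) = p by exact: divpXsubCK.
have szg : size g = n.
  by rewrite size_divp ?polyXsubC_eq0 // size_XsubC size_p subn1.
have gn : g`_n.-1 = p`_n.
  rewrite -gK mulrBr coefB coefMX coefMC gtn_eqF //.
  by rewrite [g`_n]nth_default ?szg // mul0r subr0.
have [h qE] : exists h, q = q.[x]%:P + h * ('X - x%:P).
  have /factor_theorem[h hE] : root (q - q.[x]%:P) x.
    by rewrite rootE !hornerE subrr.
  by exists h; rewrite -hE addrC subrK.
have szh : (size h <= n.-1)%N.
  have [->|h0] := eqVneq h 0; first by rewrite size_poly0.
  have : (size (h * ('X - x%:P))%R <= n)%N.
    have -> : h * ('X - x%:P) = q - q.[x]%:P by rewrite {1}qE addrAC subrr add0r.
    rewrite (leq_trans (size_polyD _ _)) // geq_max szq size_polyN.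
    by rewrite (leq_trans (size_polyC_leq1 _)).
  by rewrite size_Mmonic ?monicXsubC // size_XsubC addn2 => szh;
    rewrite -ltnS prednK.
have Lqg1 : L (q * g) = q.[x] * L g.
  have -> : q * g = q.[x] *: g + p * h.
    by rewrite {1}qE -gK -mul_polyC; ring.
  by rewrite linL Lp ?addr0 // (leq_trans szh) // leq_pred.
have Lqg2 : L (q * g) = p`_n / q`_n.-1 * L (q ^+ 2).
  have -> : q * g = (p`_n / q`_n.-1) *: q ^+ 2 + q * (g - (p`_n / q`_n.-1) *: q).
    by rewrite mulrBr -scalerAr expr2 addrC subrK.
  rewrite linL Lq ?addr0 //; apply/leq_sizeP => j.
  rewrite leq_eqVlt => /predU1P[<-|ltj].
    by rewrite coefB coefZ gn divfK // subrr.
  have lenj : (n <= j)%N by move: ltj n_gt0; lia.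
  rewrite coefB coefZ [g`_j]nth_default ?szg // [q`_j]nth_default ?mulr0 ?subrr //.
  exact: leq_trans lenj.
have Lg : L g = p`_n / q`_n.-1 * L (q ^+ 2) / q.[x].
  by rewrite -Lqg2 Lqg1 mulrAC divff // mul1r.
rewrite /lagrange_at -/g -[_ *: _]addr0 linL L0 addr0 Lg.
by field; rewrite qx0 qn0 simple.
Qed.

End GaussRule.

(** * Complexification of functionals *)

Section Complexification.
Variable R : realType.
Implicit Types (L : {poly R} -> R) (f : {poly R}).
Local Notation C := R[i].

Lemma linear_form_expand (F : fieldType) (L : {poly F} -> F) N (f : {poly F}) :
  is_linear_form L -> (size f <= N)%N -> L f = \sum_(i < N) f`_i * L 'X^i.
Proof.
move=> linL szf.
have {1}-> : f = \poly_(i < N) f`_i.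
  apply/polyP => i; rewrite coef_poly.
  by case: ltnP => // leNi; rewrite nth_default // (leq_trans szf).
rewrite {szf} poly_def; elim: N => [|N IHN].
  by rewrite !big_ord0 linear_form0.
by rewrite !big_ord_recr /= addrC linL IHN addrC.
Qed.

Lemma linear_form_ext (F : fieldType) (L1 L2 : {poly F} -> F) N :
  is_linear_form L1 -> is_linear_form L2 ->
  (forall i, (i < N)%N -> L1 'X^i = L2 'X^i) ->
  forall f : {poly F}, (size f <= N)%N -> L1 f = L2 f.
Proof.
move=> lin1 lin2 eqX f szf.
rewrite (linear_form_expand lin1 szf) (linear_form_expand lin2 szf).
by apply: eq_bigr => i _; rewrite eqX.
Qed.

(** The nodes may be complex, so the interpolation argument runs over [R[i]]. *)
Definition liftC L (f : {poly C}) : C :=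
  \sum_(i < size f) f`_i * (L 'X^i)%:C%C.

Lemma liftC_linear L : is_linear_form (liftC L).
Proof.
have E N (f : {poly C}) : (size f <= N)%N -> liftC L f = \sum_(i < N) f`_i * (L 'X^i)%:C%C.
  move=> szf; rewrite /liftC (big_ord_widen N (fun i => f`_i * (L 'X^i)%:C%C)) //.
  rewrite big_mkcond; apply: eq_bigr => i _; case: ltnP => // lei.
  by rewrite nth_default // mul0r.
move=> c f g; pose N := maxn (size (c *: f + g)) (maxn (size f) (size g)).
rewrite !(E N) ?leq_max ?leqnn ?orbT //.
rewrite mulr_sumr -big_split; apply: eq_bigr => i _ /=.
by rewrite coefD coefZ; ring.
Qed.

Lemma liftC_toC L f : is_linear_form L -> liftC L (toC f) = (L f)%:C%C.
Proof.
move=> linL.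
have szC : size (toC f) = size f by apply: size_map_inj_poly; [exact: fmorph_inj|rewrite rmorph0].
rewrite (linear_form_expand linL (leqnn _)).
rewrite /liftC szC rmorph_sum; apply: eq_bigr => i _.
by rewrite coef_map rmorphM.
Qed.

(** By linearity only powers of ['X] have to be tested, and these are real. *)
Lemma liftC_orth L (p : {poly R}) m : is_linear_form L ->
  (forall f, (size f <= m)%N -> L (p * f) = 0) ->
  forall f : {poly C}, (size f <= m)%N -> liftC L (toC p * f) = 0.
Proof.
move=> linL Lp f szf.
apply: (@linear_form_ext _ (fun g : {poly C} => liftC L (toC p * g)) (fun=> 0) m) => //.
- by move=> c q q'; rewrite mulrDr -scalerAr liftC_linear.
- by move=> c q q'; rewrite mulr0 addr0.
move=> i ltim; rewrite -(map_polyXn (real_complex R)) -rmorphM liftC_toC // Lp //.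
by rewrite size_polyXn.
Qed.

Lemma liftC_mul L L' (g : {poly R}) : is_linear_form L -> is_linear_form L' ->
  (forall f, L' f = L (g * f)) ->
  forall f : {poly C}, liftC L' f = liftC L (toC g * f).
Proof.
move=> linL linL' LL' f.
apply: (@linear_form_ext _ (liftC L') (fun h : {poly C} => liftC L (toC g * h)) (size f)) => //.
- exact: liftC_linear.
- by move=> c q q'; rewrite mulrDr -scalerAr liftC_linear.
move=> i _; rewrite -(map_polyXn (real_complex R)) -rmorphM !liftC_toC //.
by rewrite LL'.
Qed.

End Complexification.

(** * Polynomials with parameters *)

Section SpecializedFamilies.
Variable R : realType.

Lemma coef_spec k (v : 'I_k -> R) (p : {poly mpoly k R}) i :
  (spec v p)`_i = meval v p`_i.
Proof. by rewrite /spec coef_map. Qed.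

Lemma size_spec k (v : 'I_k -> R) (p : {poly mpoly k R}) :
  (size (spec v p) <= size p)%N.
Proof.
by apply/leq_sizeP => i szi; rewrite coef_spec nth_default // raddf0.
Qed.

Lemma jcoefE k N (j : 'I_N -> {poly mpoly k R}) n v i :
  jcoef j n v i = (map_poly (meval v) (j i)).[n%:R].
Proof. by rewrite /jcoef -horner_map /= rmorph_nat. Qed.

Lemma ratfam_scale k (v : 'I_k -> R) (p : mpoly k R) :
  ratfam id (fun s => meval (fun i => s * v i) p).
Proof.
apply: ratfam_meval => i; apply: ratfamM; [exact: ratfam_id|exact: ratfam_const].
Qed.

Lemma ratfam_Wform c (l r : params R c) f :
  ratfam id (fun s => Wform (fun i => s * l i) (fun i => s * r i) f).
Proof.
rewrite /Wform; apply: ratfamD; [apply: ratfamD|].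
- exact: ratfam_const.
- apply: ratfam_sum => i; apply: ratfamM; last exact: ratfam_const.
  apply: ratfamM; last exact: ratfam_const.
  by apply: ratfamM; [exact: ratfam_id|exact: ratfam_const].
- apply: ratfam_sum => i; apply: ratfamM; last exact: ratfam_const.
  by apply: ratfamM; [exact: ratfam_id|exact: ratfam_const].
Qed.

(** At the parameter [0] the polynomials are Jacobi polynomials, which keep
    their degree; the ray from [0] through the given parameter carries the
    orthogonality over. *)
Lemma Q_orth c (Q : nat -> {poly mpoly c.+1 R}) : is_Q_family Q ->
  forall n (l : params R c) (f : {poly R}), (size f <= n)%N ->
    WQ_int l (spec l (Q n) * f) = 0.
Proof.
move=> [szQ orthQ Q0 _] n l f szf.
have s1 : (fun i => 1 * l i) = l by apply/funext => i; rewrite mul1r.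
have := @orth_smaller_degree _ _ id (fun s => WQ_int (fun i => s * l i))
  (fun m s => spec (fun i => s * l i) (Q m)) (@zariski_dense_id R).
move=> /(_ _ _ _ _ _ _ 1 n f szf); rewrite s1; apply.
- by move=> s; exact: WQ_is_linear.
- move=> p; apply: eq_ratfam (ratfam_Wform l (fun=> 0) ((1 - 'X) ^+ c.+1 * p)) => s.
  rewrite (WQ_intE _ (fun=> 0)); congr Wform.
  by apply/funext => i; rewrite mulr0.
- by move=> m s; rewrite (leq_trans (size_spec _ _)) // szQ.
- by move=> m k; apply: eq_ratfam (ratfam_scale l (Q m)`_k) => s; rewrite coef_spec.
- by move=> m k s neqmk; apply: orthQ.
- exists 0 => m; have -> : (fun i => 0 * l i) = (fun=> 0).
    by apply/funext => i; rewrite mul0r.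
  by rewrite Q0 jacobi_lead.
Qed.

Lemma M_orth c (M : nat -> {poly mpoly (c.+1 + c.+1) R}) : is_M_family M ->
  forall n (l r : params R c) (f : {poly R}), (size f <= n)%N ->
    WM_int l r (spec (lr l r) (M n) * f) = 0.
Proof.
move=> [szM orthM M0 _] n l r f szf.
have lrE s : lr (fun i => s * l i) (fun i => s * r i) = (fun i => s * lr l r i).
  by apply/funext => i; rewrite /lr; case: fintype.split.
have s1 k (v : 'I_k -> R) : (fun i => 1 * v i) = v.
  by apply/funext => i; rewrite mul1r.
have := @orth_smaller_degree _ _ id
  (fun s => WM_int (fun i => s * l i) (fun i => s * r i))
  (fun m s => spec (fun i => s * lr l r i) (M m)) (@zariski_dense_id R).
move=> /(_ _ _ _ _ _ _ 1 n f szf); rewrite !s1; apply.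
- by move=> s k p p'; rewrite !WM_intE Wform_linear.
- by move=> p; apply: eq_ratfam (ratfam_Wform l r p) => s; rewrite WM_intE.
- by move=> m s; rewrite (leq_trans (size_spec _ _)) // szM.
- move=> m k; apply: eq_ratfam (ratfam_scale (lr l r) (M m)`_k) => s.
  by rewrite coef_spec.
- by move=> m k s neqmk; rewrite -lrE; apply: orthM.
- exists 0 => m; have -> : (fun i => 0 * lr l r i) = (fun=> 0).
    by apply/funext => i; rewrite mul0r.
  by rewrite M0 jacobi_lead.
Qed.

End SpecializedFamilies.

(** * The parameter attached to a point of the projective space *)

Section Recursion.
Variables (R : realType) (c : nat).
Local Notation a := c.+1.
Implicit Types (l r : params R c) (u : hcoords R c).

(** The combination of Jacobi polynomials with coordinates [u] is the
    derivative of order [a] of [Phi n u]. Also for [n <= c], where some of the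
    Jacobi polynomials vanish, [Phi n u] determines all of [u]. *)
Definition Phi n u : {poly R} := \sum_(i < c.+2) u i *: primJ R c (n + (a - i)).

Lemma derivn_Phi n u :
  (Phi n u)^`(a) = \sum_(i < c.+2) u i *: Jpoly R c (n%:Z - i%:Z).
Proof.
rewrite /Phi derivn_sum; apply: eq_bigr => i _; have ltia := ltn_ord i.
rewrite derivnZ; have [lein|ltni] := leqP i n.
  rewrite subzn // /Jpoly -derivn_primJ.
  by have -> : (n + (a - i) = n - i + a)%N by lia.
rewrite derivn_primJ_small; last lia.
by have -> : (n%:Z - (i : nat)%:Z = Negz (i - n).-1)%R by lia.
Qed.

Lemma Phi_orth n u (f : {poly R}) : (size f <= n)%N ->
  pint (-1) 1 (Phi n u * f) = 0.
Proof.
move=> szf; rewrite /Phi mulr_suml linear_sum big1 // => i _.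
by rewrite -scalerAl linearZ /= primJ_orth ?scaler0 // (leq_trans szf) ?leq_addr.
Qed.

Lemma Phi_reflect n u :
  Phi n u \Po (-1 *: 'X + 0%:P) = (-1) ^+ (n + a) *: Phi n (reflection u).
Proof.
rewrite /Phi linear_sum scaler_sumr; apply: eq_bigr => -[i /= ltia] _.
rewrite linearZ /= primJ_parity !scalerA /reflection /=; congr (_ *: _).
have aE : (-1) ^+ a = (-1) ^+ (a - i) * (-1) ^+ i :> R by rewrite -exprD subnK.
have sqi : (-1) ^+ i * (-1) ^+ i = 1 :> R by rewrite -exprMn mulrNN mulr1 expr1n.
by rewrite !exprD aE -[LHS]mulr1 -[X in _ * X = _]sqi; ring.
Qed.

Lemma LformZ k (P : {poly R}) l f : Lform (k *: P) l f = k * Lform P l f.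
Proof.
rewrite /Lform mulrBr mulr_sumr; congr (_ - _).
  by apply: eq_bigr => i _; rewrite derivnZ -scalerAl derivnZ hornerZ; ring.
rewrite /bdry !horner_sum mulr_sumr; apply: eq_bigr => i _.
by rewrite derivnZ -scalerAl !hornerZ; ring.
Qed.

(** Integration by parts separates the two end points, so a parameter found for
    [u] at the left and one found for the reflection of [u], which describes the
    mirror image of [Phi n u], at the right can be combined. *)
Lemma Phi_two_sided n u l r (f : {poly R}) :
  (forall g, Lform (Phi n u) l g = 0) ->
  (forall g, Lform (Phi n (reflection u)) r g = 0) ->
  (size f <= n + a)%N -> Wform l r ((Phi n u)^`(a) * f) = 0.
Proof.
move=> left0 right0 szf; rewrite Wform_parts left0 add0r Phi_orth; last first.
  exact: size_derivn_le.
have := Lform_reflect (Phi n u) r f; rewrite /= Phi_reflect LformZ right0 mulr0.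
move=> /esym/eqP; rewrite mulf_eq0 expf_eq0 oppr_eq0 oner_eq0 andbF /= => /eqP ->.
by rewrite mulr0 addr0.
Qed.

Variables (Q : nat -> {poly mpoly c.+1 R}) (j : 'I_c.+2 -> {poly mpoly c.+1 R}).
Hypotheses (Q_family : is_Q_family Q) (j_coefs : Q_expansion Q j).

(** For [n > c] this is the orthogonality of [Q n] integrated by parts. Up to
    the sign [(-1) ^+ n] the left hand side is rational in [n], so it vanishes
    for the remaining [n] too. *)
Lemma Lform_fmap n l f : Lform (Phi n (fmap_n j n l)) l f = 0.
Proof.
have [kappa kappa0 expQ] := j_coefs.
suff H m : (-1) ^+ m * Lform (Phi m (fmap_n j m l)) l f = 0.
  by have /eqP := H n; rewrite mulf_eq0 signr_eq0 => /eqP.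
(* ['C(m, a)] is nonzero exactly for the [m] where orthogonality is enough. *)
move: m; apply: (@ratfam_eq0 _ _ (fun n => n%:R : R) (@zariski_dense_nat R) _
  (fun m => 'C(m, a)%:R)).
- apply: (ratfam_Lform f) => [k|k]; last exact: ratfam_const.
  apply: (@eq_ratfam _ _ _ (fun m => \sum_(i < c.+2) jcoef j m l i *
    ((-1) ^+ m * (primJ R c (m + (a - i)))^`(k).[-1]))).
    move=> m; rewrite /Phi derivn_sum horner_sum mulr_sumr; apply: eq_bigr => i _.
    by rewrite [in RHS]derivnZ [in RHS]hornerZ mulrCA.
  apply: ratfam_sum => i; apply: ratfamM; last exact: ratfam_primJ.
  by apply: eq_ratfam (ratfam_poly _ (map_poly (meval l) (j i))) => m; rewrite jcoefE.
- have f0 : (a`!%:R : R) != 0 by rewrite pnatr_eq0 -lt0n fact_gt0.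
  apply: eq_ratfam (ratfamM (ratfam_ffact R 0 a) (ratfam_const _ (a`!%:R)^-1)) => m.
  by rewrite addn0 -bin_ffact natrM mulfK.
- by exists a; rewrite binn oner_neq0.
move=> m; rewrite pnatr_eq0 -lt0n bin_gt0 => leam.
rewrite (@Lform_eq0 _ _ _ _ m) ?mulr0 //; first exact: Phi_orth.
move=> g szg; rewrite derivn_Phi -expQ -scalerAl.
by rewrite (linear_formZ _ _ (@WQ_is_linear _ _ l)) Q_orth ?mulr0.
Qed.

(** Along the segment from a point of the image of [f_n] to [u] the relation
    is rational, and it holds wherever [f_n] inverts [finv]. *)
Lemma Lform_inverse n (finv : ratmap R c) u f : is_inverse (fmap_n j n) finv ->
  rdom finv u -> Lform (Phi n u) (reval finv u) f = 0.
Proof.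
move=> [_ [l0 dom0] inv0 inv] [pt_u den_u].
have [[i0 pt0] den0] := dom0.
pose u0 := fmap_n j n l0; pose seg (s : R) : hcoords R c := fun i => u0 i + s * (u i - u0 i).
pose good s := forall i, meval (seg s) (rden finv i) != 0.
pose I := {s : R | good s}; pose e (x : I) : R := sval x.
have seg0 : seg 0 = u0 by apply/funext => i; rewrite /seg mul0r addr0.
have seg1 : seg 1 = u by apply/funext => i; rewrite /seg mul1r addrC subrK.
have good0 : good 0 by move=> i; rewrite seg0; exact: den0.
have good1 : good 1 by move=> i; rewrite seg1.
have rat_seg J (e' : J -> R) i : ratfam e' (fun x => seg (e' x) i).
  apply: ratfamD; first exact: ratfam_const.
  by apply: ratfamM; [exact: ratfam_id|exact: ratfam_const].
have dense_e : zariski_dense e.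
  have [p [q pq]] : ratfam id (fun s => \prod_(i < a) meval (seg s) (rden finv i)).
    apply: ratfam_prod => i; apply: ratfam_meval => k; exact: rat_seg.
  apply: (@zariski_dense_sub _ _ _ p).
    apply/eqP => p0; have [q0] := pq 0; rewrite p0 horner0 => /eqP.
    rewrite mulf_eq0 (negPf q0) orbF => /eqP/eqP; apply/negP.
    by rewrite prodf_seq_neq0; apply/allP => i _; exact: good0.
  move=> x px; have goodx : good x.
    move=> i; apply: contraNneq px => den_i; have [_ <-] := pq x.
    by rewrite (bigD1 i) //= den_i !mul0r.
  by exists (exist _ x goodx).
have rat_g i : ratfam e (fun x => reval finv (seg (e x)) i).
  apply: ratfamM; first by apply: ratfam_meval => k; exact: rat_seg.
  apply: ratfamV; first by apply: ratfam_meval => k; exact: rat_seg.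
  by move=> [x goodx] /=; exact: goodx.
have rat_f i : ratfam e (fun x => fmap_n j n (reval finv (seg (e x))) i).
  rewrite /fmap_n /jcoef; apply: ratfam_meval; exact: rat_g.
have g0 : reval finv (seg 0) = l0.
  by apply/funext => i; rewrite seg0; exact: (inv0 l0 dom0).
suff H x : Lform (Phi n (seg (e x))) (reval finv (seg (e x))) f = 0.
  by have := H (exist _ 1 good1); rewrite /e /= seg1.
(* Nonvanishing of these coordinates makes both points honest points of the
   projective space; this is so at [f_n l0], where the segment starts. *)
move: x; apply: (@ratfam_eq0 _ _ e dense_e _
  (fun x => seg (e x) i0 * fmap_n j n (reval finv (seg (e x))) i0)).
- apply: (@eq_ratfam _ _ _ (fun x => 1 * Lform (Phi n (seg (e x))) (reval finv (seg (e x))) f)).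
    by move=> x; rewrite mul1r.
  apply: ratfam_Lform => // k.
  apply: (@eq_ratfam _ _ _ (fun x => \sum_(i < c.+2) seg (e x) i *
    (primJ R c (n + (a - i)))^`(k).[-1])).
    move=> x; rewrite mul1r /Phi derivn_sum horner_sum; apply: eq_bigr => i _.
    by rewrite [in RHS]derivnZ [in RHS]hornerZ.
  by apply: ratfam_sum => i; apply: ratfamM => //; exact: ratfam_const.
- by apply: ratfamM.
- by exists (exist _ 0 good0); rewrite /e /= g0 seg0 mulf_neq0.
move=> [s good_s]; rewrite /e /= mulf_eq0 negb_or => /andP[pt_s pt_gs].
have dom_s : rdom finv (seg s) by split=> //; exists i0.
have [k k0 kE] := inv _ dom_s (ex_intro _ i0 pt_gs).
have -> : Phi n (seg s) = k^-1 *: Phi n (fmap_n j n (reval finv (seg s))).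
  rewrite /Phi scaler_sumr; apply: eq_bigr => i _.
  by rewrite [in RHS]scalerA kE mulKf.
by rewrite LformZ Lform_fmap mulr0.
Qed.

(** The parameter [f_n^-1 (r (f_n l))] places at the right end point the masses
    that complement those of [l]. *)
Lemma Q_two_sided n (finv : ratmap R c) l (f : {poly R}) :
  is_inverse (fmap_n j n) finv -> rdom finv (reflection (fmap_n j n l)) ->
  (size f <= n + a)%N ->
  Wform l (reval finv (reflection (fmap_n j n l))) (spec l (Q n) * f) = 0.
Proof.
move=> finvP dom szf; have [kappa kappa0 expQ] := j_coefs.
apply/eqP; rewrite -(mulrI_eq0 _ (mulfI (kappa0 n))) -linear_formZ; last exact: Wform_linear.
rewrite scalerAl expQ.
rewrite -derivn_Phi Phi_two_sided // => g; first exact: Lform_fmap.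
exact: Lform_inverse.
Qed.

End Recursion.

(** * The rules as functionals *)

Section RulesAsFunctionals.
Variable R : realType.
Local Open Scope complex_scope.
Implicit Types (p q f h : {poly R}) (L : {poly R} -> R).

Lemma size_toC p : size (toC p) = size p.
Proof. by apply: size_map_inj_poly; [exact: fmorph_inj|rewrite rmorph0]. Qed.

Lemma toC_nodes p :
  toC p = lead_coef (toC p) *: \prod_(x <- nodes p) ('X - x%:P).
Proof. exact: svalP (closed_field_poly_normal (toC p)). Qed.

Lemma size_nodes p n : size p = n.+1 -> size (nodes p) = n.
Proof.
move=> szp; have := size_toC p; rewrite szp [toC p]toC_nodes size_scale.
  by rewrite size_prod_XsubC => -[].
by rewrite lead_coef_eq0 -size_poly_eq0 size_toC szp.
Qed.

Lemma size_lead p n : (size p <= n.+1)%N -> p`_n != 0 -> size p = n.+1.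
Proof.
move=> szp pn; apply/eqP; rewrite eqn_leq szp /= ltnNge.
by apply: contra pn => szn; rewrite nth_default.
Qed.

Section Gauss.
Variables (p q : {poly R}) (n : nat) (L : {poly R} -> R).
Hypotheses (linL : is_linear_form L) (size_p : size p = n.+1).
Hypothesis simple : forall x, x \in nodes p -> (toC p)^`().[x] != 0.
Hypothesis orth_p : forall f, (size f <= n)%N -> L (p * f) = 0.

Let lead_neq0 : lead_coef (toC p) != 0.
Proof. by rewrite lead_coef_eq0 -size_poly_eq0 size_toC size_p. Qed.

Lemma liftC_interpolatory m (L' : {poly R} -> R) : is_linear_form L' ->
  (forall f, (size f <= m)%N -> L' (p * f) = 0) ->
  forall h : {poly R[i]}, (size h <= n + m)%N ->
    liftC L' h = \sum_(x <- nodes p) h.[x] * liftC L' (lagrange_at (toC p) x).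
Proof.
move=> linL' orth h szh.
apply: (interpolatory (toC_nodes p) lead_neq0 simple (liftC_linear L') (m := m)).
  exact: liftC_orth.
by rewrite (size_nodes size_p).
Qed.

Lemma liftC_weight x : x \in nodes p -> (size q <= n)%N -> q`_n.-1 != 0 ->
  (toC q).[x] != 0 -> (forall f, (size f <= n.-1)%N -> L (q * f) = 0) ->
  liftC L (lagrange_at (toC p) x) =
  (p`_n / q`_n.-1 * L (q ^+ 2))%:C / ((toC p)^`().[x] * (toC q).[x]).
Proof.
move=> xin szq qn qx orth_q; have szn := size_nodes size_p.
have := christoffel_weight (toC_nodes p) lead_neq0 simple (liftC_linear L) (q := toC q) xin.
rewrite szn !coef_map => ->.
- by rewrite -rmorphXn liftC_toC // !rmorphM fmorphV.
- by rewrite fmorph_eq0.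
- by rewrite size_toC.
- exact: qx.
- exact: liftC_orth.
- exact: liftC_orth.
Qed.

End Gauss.

Variable c : nat.
Local Notation a := c.+1.
Implicit Types (l r : params R c).

Section QRule.
Variables (Q : nat -> {poly mpoly c.+1 R}) (n : nat) (l : params R c).
Hypotheses (Q_family : is_Q_family Q) (Q_def : Q_rule_defined Q n l).

Let size_Q : size (spec l (Q n)) = n.+1.
Proof.
have [[szQ _ _ _] [_ qn _ _]] := (Q_family, Q_def); apply: size_lead => //.
by rewrite (leq_trans (size_spec _ _)) // szQ.
Qed.

Let size_Q1 : (size (spec l (Q n.-1)) <= n)%N.
Proof.
have [[szQ _ _ _] [n_gt0 _ _ _]] := (Q_family, Q_def).
by rewrite (leq_trans (size_spec _ _)) // szQ prednK.
Qed.

Let den_neq0 x : x \in nodes (spec l (Q n)) ->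
  [/\ (toC (spec l (Q n)))^`().[x] != 0, (toC (spec l (Q n.-1))).[x] != 0
    & (1 - x) ^+ a != 0].
Proof.
have [_ _ _ /(_ x) den xin] := Q_def; move/den: xin.
by rewrite /Q_den !mulf_eq0 !negb_or -andbA => /and3P.
Qed.

Let weightE x : x \in nodes (spec l (Q n)) ->
  Q_weight Q n l x * (1 - x) ^+ a =
  liftC (WQ_int l) (lagrange_at (toC (spec l (Q n))) x).
Proof.
move=> xin; have [d0 q0 x0] := den_neq0 xin; have [_ _ qn1 _] := Q_def.
rewrite (@liftC_weight _ (spec l (Q n.-1)) n) //.
- rewrite /Q_weight /Q_den; move: (_ / _ * _)%:C => k.
  by field; rewrite d0 q0 x0.
- exact: WQ_is_linear.
- by move=> y /den_neq0[].
- exact: Q_orth.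
- exact: Q_orth.
Qed.

Lemma Q_rule_right r h : (size h <= n.*2)%N ->
  \sum_(x <- nodes (spec l (Q n))) Q_weight Q n l x * (toC ((1 - 'X) ^+ a * h)).[x]
  = (Wform l r ((1 - 'X) ^+ a * h))%:C.
Proof.
move=> szh; rewrite -WQ_intE -liftC_toC; last exact: WQ_is_linear.
rewrite (@liftC_interpolatory _ n size_Q _ n) ?size_toC ?addnn //.
- rewrite big_seq [RHS]big_seq; apply: eq_bigr => x xin.
  rewrite -weightE // /toC rmorphM rmorphXn rmorphB rmorph1 /= map_polyX.
  by rewrite !(hornerM, horner_exp, hornerD, hornerN, hornerX, hornerC); ring.
- by move=> y /den_neq0[].
- exact: WQ_is_linear.
- exact: Q_orth.
Qed.

(** The weights are those of the two-sided measure, because the masses at the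
    right end point do not contribute on the multiples of [(1 - 'X) ^+ a], and
    these suffice to determine the weights. *)
Lemma Q_rule_two_sided r h :
  (forall f, (size f <= n + a)%N -> Wform l r (spec l (Q n) * f) = 0) ->
  (size h <= n.*2 + a)%N ->
  \sum_(x <- nodes (spec l (Q n))) Q_weight Q n l x * (toC h).[x]
  = (Wform l r h)%:C.
Proof.
move=> orth szh; have simple y : y \in nodes (spec l (Q n)) ->
  (toC (spec l (Q n)))^`().[y] != 0 by move=> /den_neq0[].
have lin := @Wform_linear R c l r.
have interp := liftC_interpolatory size_Q simple lin orth.
rewrite -liftC_toC // interp; last by rewrite size_toC addnA addnn.
rewrite big_seq [RHS]big_seq; apply: eq_bigr => x xin.
have [d0 q0 x0] := den_neq0 xin; rewrite mulrC; congr (_ * _).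
(* Times [(1 - x) ^+ a], both weights are the integral of
   [(1 - X) ^+ a * lagrange_at x] against the two-sided measure. *)
apply: (mulIf x0); rewrite weightE //.
rewrite (@liftC_mul _ (Wform l r) _ ((1 - 'X) ^+ a)) //; first last.
- by move=> f; exact: WQ_intE.
- exact: WQ_is_linear.
have lead0 : lead_coef (toC (spec l (Q n))) != 0.
  by rewrite lead_coef_eq0 -size_poly_eq0 size_toC size_Q.
have uniq_x := uniq_of_deriv_neq0 (toC_nodes _) simple.
have valE y : (toC ((1 - 'X) ^+ a)).[y] = (1 - y) ^+ a.
  rewrite /toC rmorphXn rmorphB rmorph1 /= map_polyX.
  by rewrite !(horner_exp, hornerD, hornerN, hornerX, hornerC).
rewrite interp; last first.
  apply: leq_trans (size_polyMleq _ _) _; rewrite size_toC.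
  have sz1 : (size ((1 - 'X : {poly R}) ^+ a) <= a.+1)%N.
    have -> : (1 - 'X : {poly R}) = (-1) *: ('X - 1%:P).
      by rewrite scaleN1r opprB polyC1.
    by rewrite exprZn (leq_trans (size_scale_leq _ _)) // size_exp_XsubC.
  have := size_lagrange_at (toC_nodes (spec l (Q n))) lead0 x.
  rewrite (size_nodes size_Q) => szl.
  by move: sz1 szl; do 2 case: size => [|?]; lia.
rewrite (bigD1_seq x) //= big_seq_cond big1 ?addr0 => [|y /andP[yin neqyx]].
  rewrite hornerM (lagrange_atE (toC_nodes _) lead0 simple) // eqxx mulr1 valE.
  by rewrite mulrC.
rewrite hornerM (lagrange_atE (toC_nodes _) lead0 simple) //.
by rewrite eq_sym (negPf neqyx) mulr0 mul0r.
Qed.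

End QRule.

Lemma M_rule_exact (M : nat -> {poly mpoly (c.+1 + c.+1) R}) n l r h :
  is_M_family M -> M_rule_defined M n l r -> (size h <= n.*2)%N ->
  \sum_(x <- nodes (spec (lr l r) (M n))) M_weight M n l r x * (toC h).[x]
  = (Wform l r h)%:C.
Proof.
move=> M_family [n_gt0 pn qn1 den] szh; have [szM _ _ _] := M_family.
have size_M : size (spec (lr l r) (M n)) = n.+1.
  by apply: size_lead => //; rewrite (leq_trans (size_spec _ _)) // szM.
have size_M1 : (size (spec (lr l r) (M n.-1)) <= n)%N.
  by rewrite (leq_trans (size_spec _ _)) // szM prednK.
have {}den x : x \in nodes (spec (lr l r) (M n)) ->
    (toC (spec (lr l r) (M n)))^`().[x] != 0 /\
    (toC (spec (lr l r) (M n.-1))).[x] != 0.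
  by move=> /den; rewrite /M_den mulf_eq0 negb_or => /andP.
have simple x : x \in nodes (spec (lr l r) (M n)) ->
    (toC (spec (lr l r) (M n)))^`().[x] != 0 by move=> /den[].
have lin := @Wform_linear R c l r.
have orth k f : (size f <= k)%N -> Wform l r (spec (lr l r) (M k) * f) = 0.
  by rewrite -WM_intE; exact: M_orth.
rewrite -liftC_toC // (liftC_interpolatory size_M simple lin (orth n)); last first.
  by rewrite size_toC addnn.
rewrite big_seq [RHS]big_seq; apply: eq_bigr => x xin; rewrite mulrC; congr (_ * _).
rewrite (liftC_weight lin size_M simple (orth n) xin size_M1 qn1 _ (orth _)).
  by rewrite /M_weight WM_intE.
by have [] := den x xin.
Qed.

(** * Transport to a subinterval *)

Definition from_unit (t D : R) : {poly R} := (D / 2) *: 'X + (t + D / 2)%:P.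

Lemma rule_onE xs w (t D : R) p : rule_on xs w t D p =
  (D / 2)%:C * \sum_(x <- xs) w x * (toC (p \Po from_unit t D)).[x].
Proof.
rewrite /rule_on mulr_sumr; apply: eq_bigr => x _.
have -> : toC (p \Po from_unit t D) = toC p \Po toC (from_unit t D).
  by rewrite /toC map_comp_poly.
have -> : toC (from_unit t D) = (D / 2)%:C *: 'X + (t + D / 2)%:C%:P.
  by rewrite /toC /from_unit rmorphD /= map_polyZ map_polyX map_polyC.
rewrite horner_comp !(hornerD, hornerZ, hornerX, hornerC) mulrA.
congr (_ * _.[_]); first by field.
by field.
Qed.

Lemma pint_from_unit (t D : R) p :
  pint t (t + D) p = D / 2 * pint (-1) 1 (p \Po from_unit t D).
Proof.
have : (antideriv p \Po from_unit t D)^`() = (D / 2) *: (p \Po from_unit t D).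
  rewrite deriv_comp deriv_antideriv derivD derivZ derivX derivC addr0.
  by rewrite -scalerAr mulr1.
move=> /(congr1 (pint (-1) 1)); rewrite pint_deriv linearZ /= /GRing.scale /= => <-.
rewrite /pint !horner_comp /from_unit !(hornerD, hornerZ, hornerX, hornerC).
by congr (_.[_] - _.[_]); field.
Qed.

Lemma derivn_from_unit (t D x : R) p k :
  (p \Po from_unit t D)^`(k).[x] = (D / 2) ^+ k * p^`(k).[t + D * (x + 1) / 2].
Proof.
rewrite derivn_comp_affine hornerZ horner_comp.
rewrite !(hornerD, hornerZ, hornerX, hornerC); congr (_ * _.[_]).
by field.
Qed.

Lemma size_from_unit (t D : R) p : 0 < D -> size (p \Po from_unit t D) = size p.
Proof.
move=> D0; apply: size_comp_poly2.
have szX : size ((D / 2) *: 'X : {poly R}) = 2.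
  by rewrite size_scale ?size_polyX // mulf_neq0 ?gt_eqF // invr_gt0.
by rewrite size_polyDl szX // ltnS size_polyC_leq1.
Qed.

Lemma factor_right f : (forall k, (k <= c)%N -> f^`(k).[1] = 0) ->
  exists2 h, f = (1 - 'X) ^+ a * h & forall m, (size f <= m + a)%N -> (size h <= m)%N.
Proof.
move=> f0; have [h hE] : exists h, f = ('X - 1%:P) ^+ a * h.
  suff H k : (k <= a)%N -> exists h, f = ('X - 1%:P) ^+ k * h by exact: H.
  elim: k => [|k IHk] ltka; first by exists f; rewrite mul1r.
  have [h hE] := IHk (ltnW ltka).
  have : root h 1.
    have := f0 k ltka; rewrite hE derivn_leibniz horner_sum.
    rewrite big_ord_recl /= subn0 bin0 mulr1n big1 ?addr0 => [|i _].
      rewrite hornerM derivn_XsubC_exp subnn ffactnn hornerMn expr0 hornerC.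
      move=> /eqP; rewrite mulf_eq0 pnatr_eq0 eqn0Ngt fact_gt0 /=.
      by rewrite rootE.
    rewrite hornerMn hornerM derivn_XsubC_exp hornerMn horner_exp hornerXsubC subrr.
    by rewrite subKn // expr0n /= mul0rn mul0r mul0rn.
  by move=> /factor_theorem[g gE]; exists g; rewrite hE gE exprSr -mulrA [g * _]mulrC.
exists ((-1) ^+ a *: h) => [|m].
  have -> : (1 - 'X : {poly R}) = (-1) *: ('X - 1%:P).
    by rewrite scaleN1r opprB polyC1.
  rewrite exprZn -scalerAl -scalerAr scalerA -exprMn mulrNN mulr1 expr1n scale1r.
  exact: hE.
rewrite size_scale ?signr_eq0 //.
have [->|h0] := eqVneq h 0; first by rewrite size_poly0.
rewrite hE mulrC size_Mmonic ?monic_exp ?monicXsubC //.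
by rewrite size_exp_XsubC addnS leq_add2r.
Qed.

End RulesAsFunctionals.

(** * Exactness for splines *)

(** The masses that the two rules leave at the common knot cancel: the jets of
    both pieces agree there, and rescaling an interval by [D / 2] multiplies the
    contribution of a derivative of order [i] by [(D / 2) ^+ i.+1]. *)
Lemma masses_cancel (R : realType) (c d : nat) (t D1 D2 : R) (p q : {poly R})
    (l ls r : params R c) : 0 < D1 -> 0 < D2 ->
  is_spline c d t (t + D1) (t + D1 + D2) p q ->
  D1 / 2 * Wform l ls (p \Po from_unit t D1)
  + D2 / 2 * Wform (stretching (D2 / D1) (connection ls)) r
               (q \Po from_unit (t + D1) D2)
  = pint t (t + D1) p + pint (t + D1) (t + D1 + D2) q.
Proof.
move=> D1_gt0 D2_gt0 [_ _ p0 pq q0]; rewrite !pint_from_unit /Wform.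
have -> : \sum_(i < c.+1) l i * (-1) ^+ i * (p \Po from_unit t D1)^`(i).[-1] = 0.
  apply: big1 => i _; rewrite derivn_from_unit addNr mulr0 mul0r addr0.
  by rewrite p0 ?mulr0 // -ltnS.
have -> : \sum_(i < c.+1) r i * (q \Po from_unit (t + D1) D2)^`(i).[1] = 0.
  apply: big1 => i _; rewrite derivn_from_unit.
  have -> : t + D1 + D2 * (1 + 1) / 2 = t + D1 + D2 by field.
  by rewrite q0 ?mulr0 // -ltnS.
rewrite !addr0.
rewrite !mulrDr addrACA -[RHS]addr0; congr (_ + _).
rewrite !mulr_sumr -big_split big1 //= => i _.
rewrite !derivn_from_unit addNr mulr0 mul0r addr0.
have -> : t + D1 * (1 + 1) / 2 = t + D1 by field.
have <- : p^`(i).[t + D1] = q^`(i).[t + D1] by apply: pq; rewrite -ltnS.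
rewrite /stretching /connection; set y := (p^`(i)).[_].
have pw : (D2 / 2) ^+ i.+1 / (D2 / D1) ^+ i.+1 = (D1 / 2) ^+ i.+1.
  rewrite -expr_div_n; congr (_ ^+ _); field.
  by rewrite !gt_eqF.
have sq : (-1) ^+ i * (-1) ^+ i = 1 :> R by rewrite -exprMn mulrNN mulr1 expr1n.
transitivity (((D1 / 2) ^+ i.+1
  - ((-1) ^+ i * (-1) ^+ i) * ((D2 / 2) ^+ i.+1 / (D2 / D1) ^+ i.+1)) * (ls i * y)).
  move: y ((_ / _) ^+ i.+1)^-1 => y B {pw sq}; rewrite !exprS.
  move: (D1 / 2) (D2 / 2) => e1 e2; move: (e1 ^+ i) (e2 ^+ i) ((-1) ^+ i) => f1 f2 s.
  ring.
by rewrite pw sq mul1r subrr mul0r.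
Qed.

Theorem theorem6p1 (R : realType) (c : nat)
  (Q : nat -> {poly mpoly c.+1 R}) (M : nat -> {poly mpoly (c.+1 + c.+1) R})
  (Q_family : is_Q_family Q) (M_family : is_M_family M)
  (conjecture_c : (2 <= c)%N -> conjecture Q M)
  (j : 'I_c.+2 -> {poly mpoly c.+1 R}) (j_coefs : Q_expansion Q j)
  (n : nat) (finv : ratmap R c) (finv_inverse : is_inverse (fmap_n j n) finv)
  (t Ls Ls1 : R) (Ls_gt0 : 0 < Ls) (Ls1_gt0 : 0 < Ls1)
  (l : params R c) (Rec_def : Rec_defined j n finv l) :
  let lambda := Ls1 / Ls in
  let l' := RecS j n finv lambda l in
  (forall m d : nat,
     Q_rule_defined Q n l -> Q_rule_defined Q m l' ->
     (d <= minn (2 * n + c) (2 * m + c))%N ->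
     exact_for_splines c d t Ls Ls1 (Q_rule Q n l) (Q_rule Q m l'))
  /\
  (forall (m : nat) (r : params R c) (d : nat),
     Q_rule_defined Q n l -> M_rule_defined M m l' r ->
     (d <= minn (2 * n + c) (2 * m - 1))%N ->
     exact_for_splines c d t Ls Ls1 (Q_rule Q n l) (M_rule M m l' r)).
Proof.
move=> lambda l'; have [_ dom] := Rec_def.
pose ls := reval finv (reflection (fmap_n j n l)).
have orth (f : {poly R}) : (size f <= n + c.+1)%N -> Wform l ls (spec l (Q n) * f) = 0.
  by move=> szf; exact: Q_two_sided.
have left_rule (p : {poly R}) : Q_rule_defined Q n l -> (size p <= 2 * n + c.+1)%N ->
    Q_rule Q n l t Ls p = (Ls / 2 * Wform l ls (p \Po from_unit t Ls))%:C%C.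
  move=> Qn szp; rewrite /Q_rule rule_onE (Q_rule_two_sided Q_family Qn orth) ?rmorphM //.
  by rewrite size_from_unit // -mul2n.
have finish r rule2 d : (forall p q,
     is_spline c d t (t + Ls) (t + Ls + Ls1) p q ->
     Q_rule Q n l t Ls p = (Ls / 2 * Wform l ls (p \Po from_unit t Ls))%:C%C /\
     rule2 (t + Ls) Ls1 q =
       (Ls1 / 2 * Wform l' r (q \Po from_unit (t + Ls) Ls1))%:C%C) ->
  exact_for_splines c d t Ls Ls1 (Q_rule Q n l) rule2.
  move=> rules t1 t2 p q spl; have [-> ->] := rules p q spl; rewrite -rmorphD.
  rewrite Rintegral_spline ?ltrDl // -(masses_cancel l ls r Ls_gt0 Ls1_gt0 spl).
  by [].
split=> [m d Qn Qm led | m r d Qn Mm led].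
  apply: (finish (fun=> 0)) => p q spl; have [szp szq _ _ q0] := spl.
  split; first by apply: left_rule => //; lia.
  rewrite /Q_rule rule_onE.
  have [k|h hE szh] := @factor_right _ c (q \Po from_unit (t + Ls) Ls1).
    move=> lekc; rewrite derivn_from_unit.
    have -> : t + Ls + Ls1 * (1 + 1) / 2 = t + Ls + Ls1 by field.
    by rewrite q0 // mulr0.
  rewrite hE (Q_rule_right Q_family Qm (fun=> 0)) ?rmorphM //.
  by apply: szh; rewrite size_from_unit //; lia.
apply: (finish r) => p q spl; have [szp szq _ _ q0] := spl.
have [m_gt0 _ _ _] := Mm.
split; first by apply: left_rule => //; lia.
rewrite /M_rule rule_onE (M_rule_exact M_family Mm) ?rmorphM //.
by rewrite size_from_unit //; lia.
Qed.
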